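(* Let $(A,\Delta)$ be an algebraic quantum group and let $h$ be a group-like projection in $A$ such that the left leg and the right leg of $\Delta(h)$ coincide. Let $C$ denote the right leg of $\Delta(h)$. Then $(C,\Delta)$, with $\Delta$ restricted to $C$, is a discrete quantum group, and $h$ is the co-integral.
   Context: Algebras are over $\mathbb C$, possibly without identity, with non-degenerate product; $\otimes$ is the algebraic tensor product, $M(A)$ is the multiplier algebra of $A$, $\iota$ is the identity map. A multiplier Hopf $^*$-algebra is a $^*$-algebra $A$ with a non-degenerate coassociative $^*$-homomorphism $\Delta:A\to M(A\otimes A)$ such that $a\otimes b\mapsto\Delta(a)(1\otimes b)$ and $a\otimes b\mapsto(a\otimes1)\Delta(b)$ are bijections from $A\otimes A$ onto $A\otimes A$. It has a unique counit $\varepsilon$ and a unique antipode $S$. An algebraic quantum group is a multiplier Hopf $^*$-algebra with a positive left integral $\varphi$: a non-zero linear functional with $\varphi(a^*a)\ge0$ and $(\iota\otimes\varphi)\Delta(a)=\varphi(a)1$ for all $a\in A$. A group-like projection is a non-zero $h\in A$ with $h^2=h=h^*$ and $\Delta(h)(1\otimes h)=h\otimes h$. The right leg of $\Delta(h)$ is the smallest subspace $C$ of $A$ with $\Delta(h)(a\otimes1)\in A\otimes C$ for all $a\in A$; the left leg is the smallest subspace $C'$ of $A$ with $\Delta(h)(1\otimes a)\in C'\otimes A$ for all $a\in A$. A discrete quantum group is an algebraic quantum group $(D,\Delta)$ having a co-integral, i.e. a non-zero element $h\in D$ with $ah=\varepsilon(a)h$ for all $a\in D$ (left co-integral; a right co-integral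 satisfies $ha=\varepsilon(a)h$). *)

(* Defs.v *)
From HB Require Import structures.
From mathcomp Require Import all_boot all_order all_algebra generic_quotient.
From mathcomp Require Import boolp.

Set Implicit Arguments.
Unset Strict Implicit.
Unset Printing Implicit Defensive.
#[local] Obligation Tactic := idtac.

Import GRing.Theory Num.Theory.
Local Open Scope ring_scope.
Local Open Scope quotient_scope.

Section Bilinear.
Variables (K : comNzRingType) (A B V : lmodType K).

Definition bilin (f : A -> B -> V) : Prop :=
  (forall b, linear (f^~ b)) /\ (forall a, linear (f a)).

Definition tsum (f : A -> B -> V) (s : seq (A * B)) : V :=
  \sum_(p <- s) f p.1 p.2.

End Bilinear.

Section Tensor.
Variables (K : comNzRingType) (A B : lmodType K).

(* Formal sums of pairs are identified when no bilinear map separates them,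
   i.e. when they are congruent modulo the bilinearity relations; the
   universal property is [tlift_tn], [tlift_linear] and [tens_ext] below. *)
Definition tens_rel (s t : seq (A * B)) : bool :=
  `[< forall (V : lmodType K) (f : A -> B -> V), bilin f ->
        tsum f s = tsum f t >].

Lemma tens_rel_refl : reflexive tens_rel.
Proof. by move=> s; apply/asboolP. Qed.

Lemma tens_rel_sym : symmetric tens_rel.
Proof.
by move=> s t; apply/idP/idP => /asboolP st; apply/asboolP => V f /st.
Qed.

Lemma tens_rel_trans : transitive tens_rel.
Proof.
move=> t s u /asboolP st /asboolP tu; apply/asboolP => V f bf.
by rewrite st // tu.
Qed.

Canonical tens_equiv :=
  EquivRel tens_rel tens_rel_refl tens_rel_sym tens_rel_trans.

Definition tens : Type := {eq_quot tens_rel}.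
HB.instance Definition _ := Choice.on tens.

Definition tpi (s : seq (A * B)) : tens := \pi_{eq_quot tens_rel} s.
Definition trepr (t : tens) : seq (A * B) := repr (t : {eq_quot tens_rel}).

Definition tn (a : A) (b : B) : tens := tpi [:: (a, b)].

Definition tlift (V : lmodType K) (f : A -> B -> V) (t : tens) : V :=
  tsum f (trepr t).

Lemma tpiK t : tpi (trepr t) = t.
Proof. by rewrite /tpi /trepr reprK. Qed.

Lemma tpiP s t : tpi s = tpi t <->
  forall (V : lmodType K) (f : A -> B -> V), bilin f -> tsum f s = tsum f t.
Proof.
split; first by move=> /eqmodP /asboolP.
by move=> st; apply/eqmodP/asboolP.
Qed.

Lemma tlift_tpi (V : lmodType K) (f : A -> B -> V) s :
  bilin f -> tlift f (tpi s) = tsum f s.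
Proof.
by move=> bf; rewrite /tlift; move: (tpiK (tpi s)) => /tpiP; apply.
Qed.

Lemma tlift_inj s t :
  (forall (V : lmodType K) (f : A -> B -> V), bilin f ->
     tlift f s = tlift f t) -> s = t.
Proof.
move=> st; rewrite -(tpiK s) -(tpiK t); apply/tpiP => V f bf.
by rewrite -!(tlift_tpi _ bf) !tpiK st.
Qed.

Definition tadd (s t : tens) : tens := tpi (trepr s ++ trepr t).
Definition tscale (c : K) (t : tens) : tens :=
  tpi [seq (c *: p.1, p.2) | p <- trepr t].
Definition topp (t : tens) : tens := tscale (- 1) t.
Definition tzero : tens := tpi [::].

Section LiftOps.
Variables (V : lmodType K) (f : A -> B -> V).
Hypothesis bf : bilin f.

Lemma tlift_add s t : tlift f (tadd s t) = tlift f s + tlift f t.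
Proof. by rewrite tlift_tpi // /tsum big_cat. Qed.

Lemma bilinZl c a b : f (c *: a) b = c *: f a b.
Proof.
have f0 : f 0 b = 0.
  have := bf.1 b 1 0 0; rewrite !scale1r addr0 => /(congr1 (fun x => x - f 0 b)).
  by rewrite subrr addrK.
by have := bf.1 b c a 0; rewrite f0 !addr0.
Qed.

Lemma tlift_scale c t : tlift f (tscale c t) = c *: tlift f t.
Proof.
rewrite tlift_tpi // /tsum big_map scaler_sumr.
by apply: eq_bigr => p _; rewrite bilinZl.
Qed.

Lemma tlift_zero : tlift f tzero = 0.
Proof. by rewrite tlift_tpi // /tsum big_nil. Qed.

End LiftOps.

Lemma taddA : associative tadd.
Proof. by move=> s t u; apply: tlift_inj => V f bf; rewrite !tlift_add // addrA. Qed.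
Lemma taddC : commutative tadd.
Proof. by move=> s t; apply: tlift_inj => V f bf; rewrite !tlift_add // addrC. Qed.
Lemma tadd0 : left_id tzero tadd.
Proof.
by move=> s; apply: tlift_inj => V f bf; rewrite tlift_add // tlift_zero // add0r.
Qed.
Lemma taddN : left_inverse tzero topp tadd.
Proof.
move=> s; apply: tlift_inj => V f bf.
by rewrite tlift_add // tlift_zero // tlift_scale // scaleN1r addNr.
Qed.

HB.instance Definition _ := GRing.isZmodule.Build tens taddA taddC tadd0 taddN.

Lemma tscaleA c d t : tscale c (tscale d t) = tscale (c * d) t.
Proof. by apply: tlift_inj => V f bf; rewrite !tlift_scale // scalerA. Qed.
Lemma tscale1 : left_id 1 tscale.
Proof. by move=> t; apply: tlift_inj => V f bf; rewrite tlift_scale // scale1r. Qed.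
Lemma tscaleDr : right_distributive tscale +%R.
Proof.
move=> c s t; apply: tlift_inj => V f bf.
by rewrite tlift_scale // !tlift_add // !tlift_scale // scalerDr.
Qed.
Lemma tscaleDl t : {morph tscale^~ t : c d / c + d}.
Proof.
move=> c d; apply: tlift_inj => V f bf.
by rewrite tlift_add // !tlift_scale // scalerDl.
Qed.

HB.instance Definition _ := GRing.Zmodule_isLmodule.Build K tens
  tscaleA tscale1 tscaleDr tscaleDl.

Lemma tlift_linear (V : lmodType K) (f : A -> B -> V) :
  bilin f -> linear (tlift f).
Proof. by move=> bf c s t; rewrite tlift_add // tlift_scale. Qed.

Lemma tlift_tn (V : lmodType K) (f : A -> B -> V) a b :
  bilin f -> tlift f (tn a b) = f a b.
Proof. by move=> bf; rewrite tlift_tpi // /tsum big_seq1. Qed.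

Lemma tn_bilin : bilin tn.
Proof.
split=> x c u v; apply: tlift_inj => V f bf;
  rewrite tlift_add // tlift_scale // !tlift_tn //.
- exact: bf.1.
- exact: bf.2.
Qed.

Lemma linear_sum_seq (V W : lmodType K) (g : V -> W) (T : Type) (s : seq T)
  (F : T -> V) : linear g -> g (\sum_(p <- s) F p) = \sum_(p <- s) g (F p).
Proof.
move=> lg; have g0 : g 0 = 0.
  have := lg 1 0 0; rewrite !scale1r addr0 => /(congr1 (fun x => x - g 0)).
  by rewrite subrr addrK.
elim: s => [|p s IH]; first by rewrite !big_nil.
by rewrite !big_cons -[F p]scale1r lg IH !scale1r.
Qed.

Lemma tensE t : t = \sum_(p <- trepr t) tn p.1 p.2.
Proof.
apply: tlift_inj => V f bf; rewrite (linear_sum_seq _ _ (tlift_linear bf)).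
by apply: eq_bigr => p _; rewrite tlift_tn.
Qed.

Lemma tens_ext (V : lmodType K) (f g : tens -> V) : linear f -> linear g ->
  (forall a b, f (tn a b) = g (tn a b)) -> f =1 g.
Proof.
move=> lf lg fg t; rewrite (tensE t) !linear_sum_seq //.
by apply: eq_bigr => p _; rewrite fg.
Qed.

(* U ⊗ W as a subspace of A ⊗ B *)
Definition in_tens (U : {pred A}) (W : {pred B}) (t : tens) : Prop :=
  exists s : seq (A * B),
    all (fun p => (p.1 \in U) && (p.2 \in W)) s /\
    t = \sum_(p <- s) tn p.1 p.2.

End Tensor.

Notation "a ⊗ b" := (tn a b) (at level 40, left associativity) : ring_scope.

Section TensorMap.
Variable K : comNzRingType.
Implicit Types A B D : lmodType K.

Definition tmap A A' B B' (f : A -> A') (g : B -> B') : tens A B -> tens A' B' :=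
  tlift (fun a b => f a ⊗ g b).

Lemma tmap_bilin A A' B B' (f : A -> A') (g : B -> B') :
  linear f -> linear g -> bilin (fun a b => f a ⊗ g b).
Proof.
move=> lf lg; split=> x c u v.
  by rewrite lf (tn_bilin _ _).1.
by rewrite lg (tn_bilin _ _).2.
Qed.

Lemma tmap_linear A A' B B' (f : A -> A') (g : B -> B') :
  linear f -> linear g -> linear (tmap f g).
Proof. by move=> lf lg; apply/tlift_linear/tmap_bilin. Qed.

Lemma tmap_tn A A' B B' (f : A -> A') (g : B -> B') a b :
  linear f -> linear g -> tmap f g (a ⊗ b) = f a ⊗ g b.
Proof. by move=> lf lg; rewrite /tmap tlift_tn //; apply: tmap_bilin. Qed.

Definition tassoc A B D : tens (tens A B) D -> tens A (tens B D) :=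
  tlift (fun s d => tlift (fun a b => a ⊗ (b ⊗ d)) s).

Lemma tassoc_bilin1 A B D (d : D) :
  bilin (fun (a : A) (b : B) => a ⊗ (b ⊗ d)).
Proof.
split=> x c u v; first exact: (tn_bilin _ _).1.
by rewrite (tn_bilin _ _).1 (tn_bilin _ _).2.
Qed.

Lemma tassoc_bilin A B D :
  bilin (fun (s : tens A B) (d : D) => tlift (fun a b => a ⊗ (b ⊗ d)) s).
Proof.
split=> [d|s]; first exact/tlift_linear/tassoc_bilin1.
move=> c u v; rewrite /tlift /tsum scaler_sumr -big_split.
by apply: eq_bigr => p _; rewrite (tn_bilin _ _).2 (tn_bilin _ _).2.
Qed.

Lemma tassoc_tn A B D (a : A) (b : B) (d : D) :
  tassoc ((a ⊗ b) ⊗ d) = a ⊗ (b ⊗ d).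
Proof.
by rewrite /tassoc (tlift_tn _ _ (tassoc_bilin _ _ _)) tlift_tn //;
  apply: tassoc_bilin1.
Qed.

End TensorMap.

HB.mixin Record Lmodule_isStarAlg (K : numClosedFieldType) A
    of GRing.Lmodule K A := {
  amul : A -> A -> A;
  star : A -> A;
  amulA : associative amul;
  amul_linearl : forall b, linear (amul^~ b);
  amul_linearr : forall a, linear (amul a);
  starK : involutive star;
  starM : forall a b, star (amul a b) = amul (star b) (star a);
  star_antilinear : forall (c : K) a b,
    star (c *: a + b) = c^* *: star a + star b
}.

#[short(type="starAlgType")]
HB.structure Definition StarAlg (K : numClosedFieldType) :=
  {A of Lmodule_isStarAlg K A & GRing.Lmodule K A}.

Notation "a ** b" := (amul a b) (at level 40, left associativity) : ring_scope.

Definition nondegenerate (K : numClosedFieldType) (A : starAlgType K) : Prop :=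
  (forall a : A, (forall b, a ** b = 0) -> a = 0) /\
  (forall b : A, (forall a, a ** b = 0) -> b = 0).

(* V with scalars acting through complex conjugation, so that antilinear maps
   into V are linear maps into [conjmod V] *)
Section ConjModule.
Variables (K : numClosedFieldType) (V : lmodType K).

Definition conjmod : Type := V.
HB.instance Definition _ := GRing.Zmodule.on conjmod.

Definition conj_scale (c : K) (v : conjmod) : conjmod := c^* *: (v : V).

Lemma conj_scaleA c d v : conj_scale c (conj_scale d v) = conj_scale (c * d) v.
Proof. by rewrite /conj_scale scalerA rmorphM. Qed.
Lemma conj_scale1 : left_id 1 conj_scale.
Proof. by move=> v; rewrite /conj_scale rmorph1 scale1r. Qed.
Lemma conj_scaleDr : right_distributive conj_scale +%R.
Proof. by move=> c u v; rewrite /conj_scale scalerDr. Qed.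
Lemma conj_scaleDl v : {morph conj_scale^~ v : c d / c + d}.
Proof. by move=> c d; rewrite /conj_scale rmorphD scalerDl. Qed.

HB.instance Definition _ := GRing.Zmodule_isLmodule.Build K conjmod
  conj_scaleA conj_scale1 conj_scaleDr conj_scaleDl.

End ConjModule.

Section TensorStarAlg.
Variables (K : numClosedFieldType) (A B : starAlgType K).

Definition tmul (s t : tens A B) : tens A B :=
  tlift (fun a b => tmap (amul a) (amul b) t) s.

Definition tstar : tens A B -> tens A B :=
  tlift (fun a b => star a ⊗ star b : conjmod (tens A B)).

Lemma tmul_bilin1 (t : tens A B) :
  bilin (fun a b => tmap (amul a) (amul b) t).
Proof.
split=> x c u v; rewrite /tmap /tlift /tsum scaler_sumr -big_split;
  apply: eq_bigr => p _ /=.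
  by rewrite amul_linearl (tn_bilin _ _).1.
by rewrite amul_linearl (tn_bilin _ _).2.
Qed.

Lemma tmul_linearl t : linear (tmul^~ t).
Proof. exact/tlift_linear/tmul_bilin1. Qed.

Lemma tmul_linearr s : linear (tmul s).
Proof.
move=> c u v; rewrite /tmul {1 2 3}/tlift /tsum scaler_sumr -big_split.
by apply: eq_bigr => p _; rewrite tmap_linear //; apply: amul_linearr.
Qed.

Lemma tmul_tn a b c d : tmul (a ⊗ b) (c ⊗ d) = (a ** c) ⊗ (b ** d).
Proof.
rewrite /tmul (tlift_tn _ _ (tmul_bilin1 _)) tmap_tn //; exact: amul_linearr.
Qed.

Lemma linear_comp (U V W : lmodType K) (f : V -> W) (g : U -> V) :
  linear f -> linear g -> linear (fun x => f (g x)).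
Proof. by move=> lf lg c x y; rewrite lg lf. Qed.

Lemma tmulA : associative tmul.
Proof.
move=> s t u.
have ext3 (f g : tens A B -> tens A B) := @tens_ext K A B (tens A B) f g.
apply: (ext3 (fun s => tmul s (tmul t u)) (fun s => tmul (tmul s t) u)).
- exact: tmul_linearl.
- apply: linear_comp; exact: tmul_linearl.
move=> a b.
apply: (ext3 (fun t => tmul (a ⊗ b) (tmul t u))
             (fun t => tmul (tmul (a ⊗ b) t) u)).
- apply: (linear_comp (tmul_linearr _)); exact: tmul_linearl.
- apply: (linear_comp (tmul_linearl _)); exact: tmul_linearr.
move=> c d.
apply: (ext3 (fun u => tmul (a ⊗ b) (tmul (c ⊗ d) u))
             (tmul (tmul (a ⊗ b) (c ⊗ d)))).
- apply: (linear_comp (tmul_linearr _)); exact: tmul_linearr.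
- exact: tmul_linearr.
by move=> e f; rewrite !tmul_tn !amulA.
Qed.

Lemma tstar_bilin :
  bilin (fun (a : A) (b : B) => star a ⊗ star b : conjmod (tens A B)).
Proof.
split=> x c u v; rewrite star_antilinear.
  by rewrite (tn_bilin _ _).1.
by rewrite (tn_bilin _ _).2.
Qed.

Lemma tstar_antilinear (c : K) s t :
  tstar (c *: s + t) = c^* *: tstar s + tstar t.
Proof. exact: (tlift_linear tstar_bilin). Qed.

Lemma tstar_tn a b : tstar (a ⊗ b) = star a ⊗ star b.
Proof. exact: (tlift_tn _ _ tstar_bilin). Qed.

Lemma tstarK : involutive tstar.
Proof.
apply: (@tens_ext K A B _ (fun t => tstar (tstar t)) id).
- by move=> c s t; rewrite !tstar_antilinear conjCK.
- by [].
by move=> a b; rewrite !tstar_tn !starK.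
Qed.

Lemma tstarM s t : tstar (tmul s t) = tmul (tstar t) (tstar s).
Proof.
pose W := conjmod (tens A B).
apply: (@tens_ext K A B W (fun s => tstar (tmul s t))
                          (fun s => tmul (tstar t) (tstar s))).
- by move=> c u v; rewrite tmul_linearl tstar_antilinear.
- by move=> c u v; rewrite tstar_antilinear tmul_linearr.
move=> a b.
apply: (@tens_ext K A B W (fun t => tstar (tmul (a ⊗ b) t))
                          (fun t => tmul (tstar t) (tstar (a ⊗ b)))).
- by move=> c u v; rewrite tmul_linearr tstar_antilinear.
- by move=> c u v; rewrite tstar_antilinear tmul_linearl.
by move=> c d; rewrite tmul_tn !tstar_tn tmul_tn !starM.
Qed.

HB.instance Definition _ := Lmodule_isStarAlg.Build K (tens A B)
  tmulA tmul_linearl tmul_linearr tstarK tstarM tstar_antilinear.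

End TensorStarAlg.

Section Multiplier.
Variables (K : numClosedFieldType) (A : starAlgType K).

(* mL x a stands for xa and mR x a for ax *)
Record mult : Type := Mult {
  mL : A -> A;
  mR : A -> A;
  mL_linear : linear mL;
  mR_linear : linear mR;
  mL_mul : forall a b, mL (a ** b) = mL a ** b;
  mR_mul : forall a b, mR (a ** b) = a ** mR b;
  mLR : forall a b, a ** mL b = mR a ** b
}.

HB.instance Definition _ := gen_eqMixin mult.
HB.instance Definition _ := gen_choiceMixin mult.

Lemma multP (x y : mult) : mL x =1 mL y -> mR x =1 mR y -> x = y.
Proof.
case: x => l r p1 p2 p3 p4 p5; case: y => l' r' q1 q2 q3 q4 q5 /= /funext ll /funext rr.
subst l' r'; congr Mult; exact: Prop_irrelevance.
Qed.

HB.instance Definition _ (x : mult) :=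
  GRing.isLinear.Build K A A *:%R (mL x) (mL_linear x).
HB.instance Definition _ (x : mult) :=
  GRing.isLinear.Build K A A *:%R (mR x) (mR_linear x).
Lemma amulDl (a b c : A) : (a + b) ** c = a ** c + b ** c.
Proof. by have := amul_linearl c 1 a b; rewrite !scale1r. Qed.
Lemma amulZl (k : K) (a c : A) : (k *: a) ** c = k *: (a ** c).
Proof. exact: (bilinZl (conj (@amul_linearl _ A) (@amul_linearr _ A))). Qed.

Lemma amulDr (a b c : A) : a ** (b + c) = a ** b + a ** c.
Proof. by have := amul_linearr a 1 b c; rewrite !scale1r. Qed.
Lemma amulZr (k : K) (a c : A) : a ** (k *: c) = k *: (a ** c).
Proof.
have a0 : a ** 0 = 0 by apply: (addrI (a ** 0)); rewrite -amulDr !addr0.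
by have := amul_linearr a k c 0; rewrite a0 !addr0.
Qed.

Program Definition madd (x y : mult) : mult :=
  @Mult (fun a => mL x a + mL y a) (fun a => mR x a + mR y a) _ _ _ _ _.
Next Obligation. by move=> x y c a b; rewrite /= !linearP scalerDr addrACA. Qed.
Next Obligation. by move=> x y c a b; rewrite /= !linearP scalerDr addrACA. Qed.
Next Obligation. by move=> x y a b; rewrite /= amulDl !mL_mul. Qed.
Next Obligation. by move=> x y a b; rewrite /= amulDr !mR_mul. Qed.
Next Obligation. by move=> x y a b; rewrite /= amulDr amulDl !mLR. Qed.

Program Definition mscale (k : K) (x : mult) : mult :=
  @Mult (fun a => k *: mL x a) (fun a => k *: mR x a) _ _ _ _ _.
Next Obligation.
by move=> k x c a b; rewrite linearP scalerDr !scalerA mulrC.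
Qed.
Next Obligation.
by move=> k x c a b; rewrite linearP scalerDr !scalerA mulrC.
Qed.
Next Obligation. by move=> k x a b; rewrite /= amulZl mL_mul. Qed.
Next Obligation. by move=> k x a b; rewrite /= amulZr mR_mul. Qed.
Next Obligation. by move=> k x a b; rewrite /= amulZr amulZl mLR. Qed.

Program Definition mone : mult := @Mult id id _ _ _ _ _.
Solve All Obligations with by [].

Definition mzero : mult := mscale 0 mone.
Definition mopp (x : mult) : mult := mscale (- 1) x.

Program Definition mmul (x y : mult) : mult :=
  @Mult (fun a => mL x (mL y a)) (fun a => mR y (mR x a)) _ _ _ _ _.
Next Obligation. by move=> x y c a b; rewrite /= !linearP. Qed.
Next Obligation. by move=> x y c a b; rewrite /= !linearP. Qed.
Next Obligation. by move=> x y a b; rewrite /= !mL_mul. Qed.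
Next Obligation. by move=> x y a b; rewrite /= !mR_mul. Qed.
Next Obligation. by move=> x y a b; rewrite /= !mLR. Qed.

Lemma maddA : associative madd.
Proof. by move=> x y z; apply: multP => a /=; rewrite addrA. Qed.
Lemma maddC : commutative madd.
Proof. by move=> x y; apply: multP => a /=; rewrite addrC. Qed.
Lemma madd0 : left_id mzero madd.
Proof. by move=> x; apply: multP => a /=; rewrite scale0r add0r. Qed.
Lemma maddN : left_inverse mzero mopp madd.
Proof. by move=> x; apply: multP => a /=; rewrite scaleN1r scale0r addNr. Qed.

HB.instance Definition _ := GRing.isZmodule.Build mult maddA maddC madd0 maddN.

Lemma mscaleA c d x : mscale c (mscale d x) = mscale (c * d) x.
Proof. by apply: multP => a /=; rewrite scalerA. Qed.
Lemma mscale1 : left_id 1 mscale.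
Proof. by move=> x; apply: multP => a /=; rewrite scale1r. Qed.
Lemma mscaleDr : right_distributive mscale +%R.
Proof. by move=> c x y; apply: multP => a /=; rewrite scalerDr. Qed.
Lemma mscaleDl x : {morph mscale^~ x : c d / c + d}.
Proof. by move=> c d; apply: multP => a /=; rewrite scalerDl. Qed.

HB.instance Definition _ := GRing.Zmodule_isLmodule.Build K mult
  mscaleA mscale1 mscaleDr mscaleDl.

Lemma mmulA : associative mmul.
Proof. by move=> x y z; apply: multP. Qed.
Lemma mmul1l : left_id mone mmul.
Proof. by move=> x; apply: multP. Qed.
Lemma mmul1r : right_id mone mmul.
Proof. by move=> x; apply: multP. Qed.
Lemma mmulDl : left_distributive mmul +%R.
Proof. by move=> x y z; apply: multP => a //=; rewrite linearD. Qed.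
Lemma mmulDr : right_distributive mmul +%R.
Proof. by move=> x y z; apply: multP => a //=; rewrite linearD. Qed.

HB.instance Definition _ := GRing.Zmodule_isPzRing.Build mult
  mmulA mmul1l mmul1r mmulDl mmulDr.

Program Definition mstar (x : mult) : mult :=
  @Mult (fun a => star (mR x (star a))) (fun a => star (mL x (star a)))
    _ _ _ _ _.
Next Obligation.
by move=> x c a b; rewrite star_antilinear linearP star_antilinear conjCK.
Qed.
Next Obligation.
by move=> x c a b; rewrite star_antilinear linearP star_antilinear conjCK.
Qed.
Next Obligation. by move=> x a b; rewrite /= starM mR_mul starM starK. Qed.
Next Obligation. by move=> x a b; rewrite /= starM mL_mul starM starK. Qed.
Next Obligation.
move=> x a b; rewrite /= -[X in X ** _]starK -starM -mLR starM starK //.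
Qed.

(* the embedding of A into M(A), injective when the product is non-degenerate *)
Program Definition embed (a : A) : mult :=
  @Mult (amul a) (amul^~ a) _ _ _ _ _.
Next Obligation. by move=> a; apply: amul_linearr. Qed.
Next Obligation. by move=> a; apply: amul_linearl. Qed.
Next Obligation. by move=> a b c /=; rewrite amulA. Qed.
Next Obligation. by move=> a b c /=; rewrite amulA. Qed.
Next Obligation. by move=> a b c /=; rewrite amulA. Qed.

Lemma embed_linear : linear embed.
Proof.
move=> c a b; apply: multP => z /=; first exact: amul_linearl.
exact: amul_linearr.
Qed.

End Multiplier.

Arguments mone {K A}.

Section MultTensor.
Variables (K : numClosedFieldType) (A B : starAlgType K).

Lemma tens_ext2 (V : lmodType K) (f g : tens A B -> tens A B -> V) :
  (forall t, linear (f^~ t)) -> (forall s, linear (f s)) ->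
  (forall t, linear (g^~ t)) -> (forall s, linear (g s)) ->
  (forall a b c d, f (a ⊗ b) (c ⊗ d) = g (a ⊗ b) (c ⊗ d)) ->
  forall s t, f s t = g s t.
Proof.
move=> fl fr gl gr fg s t.
apply: (tens_ext (fl t) (gl t)) => a b.
by apply: (tens_ext (fr _) (gr _)) => c d.
Qed.

(* the image of x ⊗ y under M(A) ⊗ M(B) -> M(A ⊗ B) *)
Program Definition mtens (x : mult A) (y : mult B) : mult (tens A B) :=
  @Mult _ _ (tmap (mL x) (mL y)) (tmap (mR x) (mR y)) _ _ _ _ _.
Next Obligation. by move=> x y; apply: tmap_linear; apply: mL_linear. Qed.
Next Obligation. by move=> x y; apply: tmap_linear; apply: mR_linear. Qed.
Next Obligation.
move=> x y.
have lin : linear (tmap (mL x) (mL y)) by apply: tmap_linear; apply: mL_linear.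
apply: tens_ext2 => [t|s|t|s|a b c d].
- exact: (linear_comp lin (amul_linearl _)).
- exact: (linear_comp lin (amul_linearr _)).
- exact: (linear_comp (amul_linearl _) lin).
- exact: amul_linearr.
rewrite [(_ ⊗ _) ** _]tmul_tn !tmap_tn; try exact: mL_linear.
by rewrite [RHS]tmul_tn !mL_mul.
Qed.
Next Obligation.
move=> x y.
have lin : linear (tmap (mR x) (mR y)) by apply: tmap_linear; apply: mR_linear.
apply: tens_ext2 => [t|s|t|s|a b c d].
- exact: (linear_comp lin (amul_linearl _)).
- exact: (linear_comp lin (amul_linearr _)).
- exact: amul_linearl.
- exact: (linear_comp (amul_linearr _) lin).
rewrite [(_ ⊗ _) ** _]tmul_tn !tmap_tn; try exact: mR_linear.
by rewrite [RHS]tmul_tn !mR_mul.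
Qed.
Next Obligation.
move=> x y.
have linL : linear (tmap (mL x) (mL y)) by apply: tmap_linear; apply: mL_linear.
have linR : linear (tmap (mR x) (mR y)) by apply: tmap_linear; apply: mR_linear.
apply: tens_ext2 => [t|s|t|s|a b c d].
- exact: amul_linearl.
- exact: (linear_comp (amul_linearr _) linL).
- exact: (linear_comp (amul_linearl _) linR).
- exact: amul_linearr.
rewrite !tmap_tn; try exact: mL_linear; try exact: mR_linear.
by rewrite [LHS]tmul_tn [RHS]tmul_tn !mLR.
Qed.

Lemma mtens_bilin : bilin mtens.
Proof.
split=> [y c u v|x c u v]; apply: multP => t;
  rewrite /= /tmap /tlift /tsum scaler_sumr -big_split;
  apply: eq_bigr => p _ /=.
- by rewrite (tn_bilin _ _).1.
- by rewrite (tn_bilin _ _).1.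
- by rewrite (tn_bilin _ _).2.
- by rewrite (tn_bilin _ _).2.
Qed.

End MultTensor.

Section MultiplierHopf.
Variables (K : numClosedFieldType) (A : starAlgType K).
Variable Delta : {linear A -> mult (tens A A)}.
Implicit Types (a b c h : A) (s t : tens A A) (C : submodClosed A).

Definition legl a : mult (tens A A) := mtens (embed a) 1. (* a ⊗ 1 *)
Definition legr a : mult (tens A A) := mtens 1 (embed a). (* 1 ⊗ a *)

Definition star_hom : Prop :=
  (forall a b, Delta (a ** b) = Delta a * Delta b) /\
  (forall a, Delta (star a) = mstar (Delta a)).

(* Delta(A)(A ⊗ A) and (A ⊗ A)Delta(A) both span A ⊗ A *)
Definition nondegenerate_hom : Prop :=
  forall t,
    (exists u : seq (A * tens A A), t = \sum_(p <- u) mL (Delta p.1) p.2) /\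
    (exists u : seq (A * tens A A), t = \sum_(p <- u) mR (Delta p.1) p.2).

Definition Delta_id : tens A A -> mult (tens (tens A A) A) :=
  tlift (fun a b => mtens (Delta a) (embed b)).
Definition id_Delta : tens A A -> mult (tens A (tens A A)) :=
  tlift (fun a b => mtens (embed a) (Delta b)).

Lemma Delta_id_bilin : bilin (fun a b => mtens (Delta a) (embed b)).
Proof.
split=> x c u v; first by rewrite linearP (mtens_bilin _ _).1.
by rewrite embed_linear (mtens_bilin _ _).2.
Qed.

Lemma id_Delta_bilin : bilin (fun a b => mtens (embed a) (Delta b)).
Proof.
split=> x c u v; last by rewrite linearP (mtens_bilin _ _).2.
by rewrite embed_linear (mtens_bilin _ _).1.
Qed.

(* equality modulo the identification of (A ⊗ A) ⊗ A with A ⊗ (A ⊗ A) *)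
Definition assoc_eq (x : mult (tens (tens A A) A))
    (y : mult (tens A (tens A A))) : Prop :=
  forall t : tens (tens A A) A,
    tassoc (mL x t) = mL y (tassoc t) /\
    tassoc (mR x t) = mR y (tassoc t).

(* Van Daele's form of (Delta ⊗ id)Delta = (id ⊗ Delta)Delta:
   (a ⊗ 1 ⊗ 1)(Delta ⊗ id)(Delta(b)(1 ⊗ c))
     = (id ⊗ Delta)((a ⊗ 1)Delta(b))(1 ⊗ 1 ⊗ c),
   s and t being the arguments of Delta ⊗ id and id ⊗ Delta *)
Definition coassociative : Prop :=
  forall a b c s t,
    embed s = Delta b * legr c -> embed t = legl a * Delta b ->
    assoc_eq (mtens (legl a) 1 * Delta_id s) (id_Delta t * mtens 1 (legr c)).

Definition canonical_bijections : Prop :=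
  (exists T : {linear tens A A -> tens A A}, bijective T /\
     forall a b, embed (T (a ⊗ b)) = Delta a * legr b) /\
  (exists T : {linear tens A A -> tens A A}, bijective T /\
     forall a b, embed (T (a ⊗ b)) = legl a * Delta b).

Definition multiplier_hopf_star : Prop :=
  [/\ nondegenerate A, star_hom, nondegenerate_hom, coassociative
    & canonical_bijections].

Definition id_slice (f : {scalar A}) : tens A A -> A :=
  tlift (fun a b => f b *: a).
Definition slice_id (f : {scalar A}) : tens A A -> A :=
  tlift (fun a b => f a *: b).

Lemma id_slice_bilin (f : {scalar A}) : bilin (fun a b : A => f b *: a).
Proof.
split=> x c u v; first by rewrite scalerDr !scalerA mulrC.
by rewrite linearP scalerDl scalerA.
Qed.

Lemma slice_id_bilin (f : {scalar A}) : bilin (fun a b : A => f a *: b).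
Proof.
split=> x c u v; first by rewrite linearP scalerDl scalerA.
by rewrite scalerDr !scalerA mulrC.
Qed.

(* x = (id ⊗ f)(m), i.e. xb = (id ⊗ f)(m(b ⊗ 1)) and bx = (id ⊗ f)((b ⊗ 1)m) *)
Definition is_mult_slice (f : {scalar A}) (m : mult (tens A A)) (x : mult A) :
    Prop :=
  forall b,
    (exists t, embed t = m * legl b /\ id_slice f t = mL x b) /\
    (exists t, embed t = legl b * m /\ id_slice f t = mR x b).

Definition positive_left_integral (phi : {scalar A}) : Prop :=
  [/\ exists a, phi a != 0,
      forall a, 0 <= phi (star a ** a)
    & forall a, is_mult_slice phi (Delta a) (phi a *: (1 : mult A))].

Definition algebraic_quantum_group : Prop :=
  multiplier_hopf_star /\ exists phi, positive_left_integral phi.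

(* (eps ⊗ id)(Delta(a)(1 ⊗ b)) = ab and (id ⊗ eps)((a ⊗ 1)Delta(b)) = ab *)
Definition is_counit (eps : {scalar A}) : Prop :=
  [/\ forall a b, eps (a ** b) = eps a * eps b,
      forall a b t, embed t = Delta a * legr b -> slice_id eps t = a ** b
    & forall a b t, embed t = legl a * Delta b -> id_slice eps t = a ** b].

Definition left_cointegral h : Prop :=
  h != 0 /\ exists2 eps, is_counit eps & forall a, a ** h = eps a *: h.

Definition right_cointegral h : Prop :=
  h != 0 /\ exists2 eps, is_counit eps & forall a, h ** a = eps a *: h.

Definition discrete_quantum_group : Prop :=
  algebraic_quantum_group /\ exists h, left_cointegral h.

Definition group_like_projection h : Prop :=
  [/\ h != 0, h ** h = h, star h = h & Delta h * legr h = embed (h ⊗ h)].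

Definition contains_right_leg h C : Prop :=
  forall a, exists2 t, embed t = Delta h * legl a & in_tens predT C t.
Definition contains_left_leg h C : Prop :=
  forall a, exists2 t, embed t = Delta h * legr a & in_tens C predT t.

Definition is_right_leg h C : Prop :=
  contains_right_leg h C /\
  forall C' : submodClosed A, contains_right_leg h C' -> {subset C <= C'}.
Definition is_left_leg h C : Prop :=
  contains_left_leg h C /\
  forall C' : submodClosed A, contains_left_leg h C' -> {subset C <= C'}.

End MultiplierHopf.

Section StarSubalgebra.
Variables (K : numClosedFieldType) (A : starAlgType K) (C : submodClosed A).

Definition star_closed : Prop :=
  (forall a b, a \in C -> b \in C -> a ** b \in C) /\
  (forall a, a \in C -> star a \in C).

(* the subspace C with the operations of A; the closure proof is a phantom
   parameter that lets the star-algebra instance be inferred *)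
Record subalg (clC : star_closed) : Type :=
  Subalg { subalg_val : A; subalg_valP : subalg_val \in C }.

Variable clC : star_closed.
Local Notation D := (subalg clC).

HB.instance Definition _ := [isSub for @subalg_val clC].
HB.instance Definition _ := [Choice of D by <:].
HB.instance Definition _ := [SubChoice_isSubLmodule of D by <:].

Definition submul (x y : D) : D :=
  Subalg clC (clC.1 _ _ (subalg_valP x) (subalg_valP y)).
Definition substar (x : D) : D := Subalg clC (clC.2 _ (subalg_valP x)).

Lemma submulA : associative submul.
Proof. by move=> x y z; apply: val_inj; rewrite /= amulA. Qed.
Lemma submul_linearl y : linear (submul^~ y).
Proof. by move=> c u v; apply: val_inj; rewrite /= amul_linearl. Qed.
Lemma submul_linearr x : linear (submul x).
Proof. by move=> c u v; apply: val_inj; rewrite /= amul_linearr. Qed.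
Lemma substarK : involutive substar.
Proof. by move=> x; apply: val_inj; rewrite /= starK. Qed.
Lemma substarM x y : substar (submul x y) = submul (substar y) (substar x).
Proof. by apply: val_inj; rewrite /= starM. Qed.
Lemma substar_antilinear (c : K) x y :
  substar (c *: x + y) = c^* *: substar x + substar y.
Proof. by apply: val_inj; rewrite /= star_antilinear. Qed.

HB.instance Definition _ := Lmodule_isStarAlg.Build K D
  submulA submul_linearl submul_linearr substarK substarM substar_antilinear.

(* DeltaC(c) is the restriction of the multiplier Delta(c) to C ⊗ C *)
Definition restricts (Delta : {linear A -> mult (tens A A)})
    (DeltaC : {linear D -> mult (tens D D)}) : Prop :=
  let incl : tens D D -> tens A A := tmap val val in
  forall (c : D) (t : tens D D),
    incl (mL (DeltaC c) t) = mL (Delta (val c)) (incl t) /\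
    incl (mR (DeltaC c) t) = mR (Delta (val c)) (incl t).

End StarSubalgebra.

(* Main.v *)
(* Slices by linear functionals detect everything in an algebraic tensor
   product (over a field every subspace has a complement), so the calculations
   with legs reduce to identities in A between the operators
   x |-> ω(a x_(1)) x_(2) and x |-> x_(1) ω(x_(2) b).  Coassociativity says that
   these operators commute with the Galois maps, which yields the counit ε and
   the antipode S, as a left multiplier.
   For c in C the relation ch = ε(c)h = hc comes from Δ(h)(1 ⊗ h) = h ⊗ h.
   Describing C as the left leg gives Δ(h)(h ⊗ 1) = h ⊗ h as well.  Then both
   h ⊗ C and C ⊗ h lie in the images of C ⊗ C under the two Galois maps, hence so
   does C ⊗ C.  Applying Δ(c)Δ(h) = ε(c)Δ(h) shows that CC is contained in C,
   and h_(1) S(h_(2)) = 1 shows CA = A, which makes the product of C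
   non-degenerate.  If φ(h) = 0, positivity forces φ(hA) = 0, then invariance
   forces φ(CA) = 0, contradicting CA = A and φ <> 0; so φ is a non-zero
   integral on C. *)
From HB Require Import structures.
From mathcomp Require Import all_boot all_order all_algebra reals complex.
From mathcomp Require Import boolp classical_sets.
Require Import Defs.

Set Implicit Arguments.
Unset Strict Implicit.
Unset Printing Implicit Defensive.

Import GRing.Theory Num.Theory.
Local Open Scope classical_set_scope.
Local Open Scope ring_scope.

(** [Delta a] is only a multiplier, so a Sweedler expression makes sense only when its legs are
    covered by elements of A. Slicing [T2 (a ⊗ x)] and [T1 (x ⊗ b)] provides this and describes C
    twice, as the span of the [lconv a f h] and as the span of the [rconv b g h]; a statement linear
    in c is then checked on either set of generators. The order of the argument is dictated by a
    near-circularity. That T1 and T2 map C ⊗ C into itself relies on C being closed under products,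
    while closure under products is drawn from preimages under T2. Hence the inclusion of C ⊗ C in
    its images is established before C is known to be an algebra, by explicit preimages. It also
    makes [T1i] and [T2i] preserve C ⊗ C, which is what bijectivity on C comes down to. *)

Section Bundle.
Variables (K : pzRingType) (U V : lmodType K).

(** The proof of linearity is an argument of the constant, so that a function known to be linear
    only by a local proof still gets its linear structure by inference. *)
Definition bundled (f : U -> V) (lf : linear f) : U -> V := f.
HB.instance Definition _ f lf :=
  GRing.isLinear.Build K U V *:%R (@bundled f lf) lf.
Definition to_linear (f : U -> V) (lf : linear f) : {linear U -> V} :=
  @bundled f lf.

Definition bundled_scalar (f : U -> K) (lf : scalar f) : U -> K := f.
HB.instance Definition _ f lf :=
  GRing.isLinear.Build K U K *%R (@bundled_scalar f lf) lf.
Definition to_scalar (f : U -> K) (lf : scalar f) : {scalar U} :=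
  @bundled_scalar f lf.

End Bundle.

(** * Subspaces, functionals and slices of tensors *)

Section Complements.
Variables (K : fieldType) (V : lmodType K).
Implicit Types W : set V.

Definition subspace W := W 0 /\ forall c x y, W x -> W y -> W (c *: x + y).

Lemma subspaceZ W c x : subspace W -> W x -> W (c *: x).
Proof. by move=> [W0 Wl] Wx; rewrite -[_ *: _]addr0; apply: Wl. Qed.

Lemma subspaceD W x y : subspace W -> W x -> W y -> W (x + y).
Proof. by move=> [W0 Wl] Wx Wy; rewrite -[x]scale1r; apply: Wl. Qed.

Lemma subspaceB W x y : subspace W -> W x -> W y -> W (x - y).
Proof. by move=> [W0 Wl] Wx Wy; rewrite addrC -scaleN1r; apply: Wl. Qed.

Lemma complement_exists W : subspace W -> exists M, [/\ subspace M,
  forall x, M x -> W x -> x = 0 & forall v, exists2 m, M m & W (v - m)].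
Proof.
move=> sW.
(* [P] does not ask for 0 in X, because the union of the empty chain is empty; 0 is recovered below
   by comparing an empty M with {0}. *)
pose P (X : set V) := (forall c x y, X x -> X y -> X (c *: x + y)) /\
  (forall x, X x -> W x -> x = 0).
have [|M [[Ml MW] Mmax]] := @Zorn_bigcup V P.
  move=> F FP totF; split=> [c x y [X FX Xx] [Y FY Yy]|x [X FX Xx]].
    have [XY|YX] := totF _ _ FX FY.
      by exists Y => //; apply: (FP _ FY).1 => //; apply: XY.
    by exists X => //; apply: (FP _ FX).1 => //; apply: YX.
  exact: (FP _ FX).2.
have M0 : M 0.
  apply: contrapT => M0.
  have ME x : ~ M x.
    by move=> Mx; apply: M0; rewrite -[0](addNr x) -scaleN1r; apply: Ml.
  have: M `<` [set 0] by split=> [x /ME//|/(_ 0 erefl)].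
  by move=> /Mmax; apply; split=> [c x y -> ->|x -> //]; rewrite scaler0 addr0.
have sM : subspace M by [].
exists M; split=> // v.
apply: contrapT => nv.
(* For v outside M + W, adding the line of v to M still meets W trivially: m + c v in W with c
   nonzero would put v in M + W. *)
pose N := [set x | exists2 m, M m & exists c, x = m + c *: v].
have vN : N v by exists 0 => //; exists 1; rewrite scale1r add0r.
have /Mmax : M `<` N.
  split=> [x Mx|/(_ v vN) Mv].
    by exists x => //; exists 0; rewrite scale0r addr0.
  by apply: nv; exists v; rewrite ?subrr //; case: sW.
apply; split=> [c x y [m Mm [d ->]] [n Mn [e ->]]|x [m Mm [c ->]] Wx].
  exists (c *: m + n); first exact: Ml.
  by exists (c * d + e); rewrite scalerDr scalerA scalerDl addrACA.
have [c0|c0] := eqVneq c 0.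
  by move: Wx; rewrite c0 scale0r addr0; apply: MW.
case: nv; exists (- c^-1 *: m); first exact: subspaceZ.
rewrite scaleNr opprK addrC.
have -> : c^-1 *: m + v = c^-1 *: (m + c *: v).
  by rewrite scalerDr scalerA mulVf // scale1r.
exact: subspaceZ.
Qed.

Lemma projection_exists W : subspace W ->
  exists pi : {linear V -> V}, (forall v, W (pi v)) /\ (forall w, W w -> pi w = w).
Proof.
move=> sW; have [M [sM MW Mex]] := complement_exists sW.
have /choice[p pP] : forall v, exists m, M m /\ W (v - m).
  by move=> v; have [m ? ?] := Mex v; exists m.
have uniq_p v m : M m -> W (v - m) -> p v = m.
  move=> Mm Wm; apply/eqP; rewrite -subr_eq0; apply/eqP/MW.
    by apply: subspaceB => //; case: (pP v).
  have -> : p v - m = (v - m) - (v - p v) by rewrite opprB [RHS]addrC addrA subrK.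
  by apply: subspaceB => //; case: (pP v).
have lp : linear (fun v => v - p v).
  move=> c u v; rewrite (uniq_p _ (c *: p u + p v)).
  - by rewrite scalerBr opprD addrACA.
  - by apply: sM.2; [case: (pP u)|case: (pP v)].
  have -> : c *: u + v - (c *: p u + p v) = c *: (u - p u) + (v - p v).
    by rewrite scalerBr opprD addrACA.
  by apply: sW.2; [case: (pP u)|case: (pP v)].
exists (to_linear lp); split=> [v|w Ww] /=; first by case: (pP v).
by rewrite /to_linear /= /bundled (uniq_p w 0) ?subr0 //; case: sM.
Qed.

Lemma functional_exists (v : V) : v != 0 -> exists f : {scalar V}, f v = 1.
Proof.
move=> v0; pose W := [set x | exists c, x = c *: v].
have sW : subspace W.
  split=> [|c x y [d ->] [e ->]]; first by exists 0; rewrite scale0r.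
  by exists (c * d + e); rewrite scalerA scalerDl.
have [pi [piW pi_id]] := projection_exists sW.
have /choice[f fP] : forall x, exists c, pi x = c *: v by [].
have lf : scalar f.
  move=> c x y; apply/eqP; rewrite -subr_eq0.
  have: (f (c *: x + y) - (c * f x + f y)) *: v == 0.
    by rewrite scalerBl scalerDl -scalerA -!fP linearP subrr.
  by rewrite scaler_eq0 (negbTE v0) orbF.
exists (to_scalar lf); apply/eqP; rewrite /to_scalar /= /bundled_scalar -subr_eq0.
have: (f v - 1) *: v == 0.
  rewrite scalerBl scale1r -fP pi_id ?subrr //; by exists 1; rewrite scale1r.
by rewrite scaler_eq0 (negbTE v0) orbF.
Qed.

Lemma functionals_separate (u v : V) :
  (forall f : {scalar V}, f u = f v) -> u = v.
Proof.
move=> uv; apply/eqP; rewrite -subr_eq0; apply/negPn/negP => /functional_exists[f].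
by rewrite linearB /= uv subrr => /esym/eqP; rewrite oner_eq0.
Qed.

Lemma separating_functional W v : subspace W -> ~ W v ->
  exists f : {scalar V}, (forall w, W w -> f w = 0) /\ f v = 1.
Proof.
move=> sW nWv; have [pi [piW pi_id]] := projection_exists sW.
have [|f fv] := @functional_exists (v - pi v).
  by apply/eqP => /eqP; rewrite subr_eq0 => /eqP vE; apply: nWv; rewrite vE.
have lg : scalar (fun x => f (x - pi x)).
  by move=> c x y; rewrite linearP opprD addrACA -scalerBr linearP.
exists (to_scalar lg); split=> // w Ww.
by rewrite /to_scalar /= /bundled_scalar pi_id // subrr linear0.
Qed.

Lemma subspace_by_functionals W v : subspace W ->
  (forall f : {scalar V}, (forall w, W w -> f w = 0) -> f v = 0) -> W v.
Proof.
move=> sW Wv; apply: contrapT => /(separating_functional sW)[f [/Wv->]].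
by move/esym/eqP; rewrite oner_eq0.
Qed.

Lemma subspace_setT : subspace setT.
Proof. by []. Qed.

End Complements.
Arguments subspace_setT {K} V.

Section Slices.
Variables (K : fieldType) (A B : lmodType K).
Implicit Types (f : {scalar A}) (g : {scalar B}) (s t : tens A B).

HB.instance Definition _ (A' B' : lmodType K) (f : {linear A -> A'})
    (g : {linear B -> B'}) :=
  GRing.isLinear.Build K _ _ *:%R (tmap f g)
    (tmap_linear (@linearP _ _ _ _ f) (@linearP _ _ _ _ g)).

(** On A ⊗ A these two are convertible to [slice_id] and [id_slice]; the factors may differ here,
    since tensors in A ⊗ (A ⊗ A) are sliced as well. *)
Definition lslice f : tens A B -> B := tlift (fun a b => f a *: b).
Definition rslice g : tens A B -> A := tlift (fun a b => g b *: a).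

Lemma lslice_bilin f : bilin (fun a (b : B) => f a *: b).
Proof.
split=> x c u v; first by rewrite linearP scalerDl scalerA.
by rewrite scalerDr !scalerA mulrC.
Qed.
Lemma rslice_bilin g : bilin (fun (a : A) b => g b *: a).
Proof.
split=> x c u v; first by rewrite scalerDr !scalerA mulrC.
by rewrite linearP scalerDl scalerA.
Qed.

HB.instance Definition _ f :=
  GRing.isLinear.Build K _ _ *:%R (lslice f) (tlift_linear (lslice_bilin f)).
HB.instance Definition _ g :=
  GRing.isLinear.Build K _ _ *:%R (rslice g) (tlift_linear (rslice_bilin g)).

Lemma lslice_tn f a b : lslice f (a ⊗ b) = f a *: b.
Proof. exact: (tlift_tn _ _ (lslice_bilin f)). Qed.
Lemma rslice_tn g a b : rslice g (a ⊗ b) = g b *: a.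
Proof. exact: (tlift_tn _ _ (rslice_bilin g)). Qed.

Lemma tens_ind (P : tens A B -> Prop) :
  P 0 -> (forall a b, P (a ⊗ b)) -> (forall s t, P s -> P t -> P (s + t)) ->
  forall t, P t.
Proof.
by move=> P0 Pt PD t; rewrite (tensE t); apply: big_ind => // p _; apply: Pt.
Qed.

Lemma tnDl (a a' : A) (b : B) : (a + a') ⊗ b = a ⊗ b + a' ⊗ b.
Proof. by have := (tn_bilin A B).1 b 1 a a'; rewrite !scale1r. Qed.
Lemma tnDr (a : A) (b b' : B) : a ⊗ (b + b') = a ⊗ b + a ⊗ b'.
Proof. by have := (tn_bilin A B).2 a 1 b b'; rewrite !scale1r. Qed.
Lemma tn0r (a : A) : a ⊗ (0 : B) = 0.
Proof. by apply: (addrI (a ⊗ 0)); rewrite -tnDr !addr0. Qed.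
Lemma tn0l (b : B) : (0 : A) ⊗ b = 0.
Proof. by apply: (addrI (0 ⊗ b)); rewrite -tnDl !addr0. Qed.
Lemma tnZl c (a : A) (b : B) : (c *: a) ⊗ b = c *: (a ⊗ b).
Proof. exact: (bilinZl (tn_bilin A B)). Qed.
Lemma tnZr c (a : A) (b : B) : a ⊗ (c *: b) = c *: (a ⊗ b).
Proof. by have := (tn_bilin A B).2 a c b 0; rewrite tn0r !addr0. Qed.
Lemma tn_suml I (r : seq I) (F : I -> A) (b : B) :
  (\sum_(i <- r) F i) ⊗ b = \sum_(i <- r) F i ⊗ b.
Proof. by elim/big_rec2: _ => [|i x y _ <-]; rewrite ?tn0l ?tnDl. Qed.
Lemma tn_sumr I (r : seq I) (F : I -> B) (a : A) :
  a ⊗ (\sum_(i <- r) F i) = \sum_(i <- r) a ⊗ F i.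
Proof. by elim/big_rec2: _ => [|i x y _ <-]; rewrite ?tn0r ?tnDr. Qed.

Lemma slice_exchange f g t : g (lslice f t) = f (rslice g t).
Proof.
elim/tens_ind: t => [|a b|s t]; rewrite ?linear0 ?linearD //=.
  by rewrite lslice_tn rslice_tn !linearZ /= mulrC.
by move=> -> ->.
Qed.

(** Induction on the number of terms. If the first vector of the leading pair lies in the span of
    the other first vectors, that term is absorbed by the others; if not, a functional equal to 1 on
    it and 0 on the others isolates its second vector, which is therefore 0. *)
Lemma lslice_eq0 t : (forall f, lslice f t = 0) -> t = 0.
Proof.
rewrite (tensE t); move: (trepr t) => s; have [n] := ubnP (size s).
elim: n s => // n IH [|p s] /=; first by rewrite big_nil.
rewrite ltnS => sn t0; pose x i := (nth p s i).1.
pose W : set A := [set a | exists F : nat -> K, a = \sum_(i < size s) F i *: x i].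
have sW : subspace W.
  split=> [|c _ _ [F ->] [G ->]].
    by exists (fun=> 0); rewrite big1 // => i _; rewrite scale0r.
  exists (fun i => c * F i + G i); rewrite scaler_sumr -big_split.
  by apply: eq_bigr => i _; rewrite /= scalerDl scalerA.
have sE (V : zmodType) (G : A * B -> V) :
    \sum_(q <- s) G q = \sum_(i < size s) G (nth p s i).
  by rewrite (big_nth p) big_mkord.
have [[F pE]|/(separating_functional sW)[f [fW fp]]] := EM (W p.1); last first.
  have fx q : q \in s -> f q.1 = 0.
    move=> qs; apply: fW; exists (fun i => (i == index q s)%:R).
    rewrite -index_mem in qs; rewrite (bigD1 (Ordinal qs)) //= eqxx scale1r.
    rewrite big1 ?addr0; first by rewrite /x nth_index // -index_mem.
    move=> i; rewrite -val_eqE /= => /negbTE->; by rewrite scale0r.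
  have p2 : p.2 = 0.
    have := t0 f; rewrite big_cons linearD /= lslice_tn fp scale1r.
    rewrite linear_sum /= big_seq big1 ?addr0 // => q qs.
    by rewrite lslice_tn fx // scale0r.
  move: t0; rewrite big_cons p2 tn0r add0r => t0; exact: IH.
have E : \sum_(q <- p :: s) q.1 ⊗ q.2 =
    \sum_(q <- [seq (x i, (nth p s i).2 + F i *: p.2) | i <- iota 0 (size s)])
      q.1 ⊗ q.2.
  rewrite big_cons sE pE tn_suml -big_split big_map /=.
  have -> : iota 0 (size s) = index_iota 0 (size s) by rewrite /index_iota subn0.
  rewrite big_mkord.
  by apply: eq_bigr => i _; rewrite tnDr tnZl tnZr addrC.
by rewrite E in t0 *; apply: IH t0; rewrite size_map size_iota.
Qed.

Lemma rslice_eq0 t : (forall g, rslice g t = 0) -> t = 0.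
Proof.
move=> t0; apply: lslice_eq0 => f; apply: functionals_separate => g.
by rewrite slice_exchange t0 !linear0.
Qed.

Lemma lslice_inj s t : (forall f, lslice f s = lslice f t) -> s = t.
Proof.
move=> st; apply/eqP; rewrite -subr_eq0; apply/eqP/lslice_eq0 => f.
by rewrite linearB /= st subrr.
Qed.
Lemma rslice_inj s t : (forall g, rslice g s = rslice g t) -> s = t.
Proof.
move=> st; apply/eqP; rewrite -subr_eq0; apply/eqP/rslice_eq0 => f.
by rewrite linearB /= st subrr.
Qed.

End Slices.

Section SliceMaps.
Variables (K : fieldType) (A B A' B' : lmodType K).
Variables (u : {linear A -> A'}) (v : {linear B -> B'}).

Lemma tmapE a b : tmap u v (a ⊗ b) = u a ⊗ v b.
Proof. by apply: tmap_tn; apply: linearP. Qed.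

Lemma tmapD s t : tmap u v (s + t) = tmap u v s + tmap u v t.
Proof. exact: linearD. Qed.

Lemma tmap_sum I (r : seq I) (F : I -> tens A B) :
  tmap u v (\sum_(i <- r) F i) = \sum_(i <- r) tmap u v (F i).
Proof. exact: linear_sum. Qed.

Lemma lslice_tmap (f : {scalar A'}) t :
  lslice f (tmap u v t) = v (lslice (f \o u : {scalar A}) t).
Proof.
elim/tens_ind: t => [|a b|s t Hs Ht]; first by rewrite !linear0.
  by rewrite tmapE !lslice_tn linearZ.
by rewrite !linearD /= Hs Ht.
Qed.

Lemma rslice_tmap (g : {scalar B'}) t :
  rslice g (tmap u v t) = u (rslice (g \o v : {scalar B}) t).
Proof.
elim/tens_ind: t => [|a b|s t Hs Ht]; first by rewrite !linear0.
  by rewrite tmapE !rslice_tn linearZ.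
by rewrite !linearD /= Hs Ht.
Qed.

End SliceMaps.

Lemma tmap_comp (K : fieldType) (A B A' B' A'' B'' : lmodType K)
    (u : {linear A -> A'}) (v : {linear B -> B'})
    (u' : {linear A' -> A''}) (v' : {linear B' -> B''}) t :
  tmap u' v' (tmap u v t) = tmap (u' \o u) (v' \o v) t.
Proof.
elim/tens_ind: t => [|a b|s t Hs Ht]; rewrite ?linear0 ?tmapE //.
by rewrite !linearD /= Hs Ht.
Qed.

Lemma tmap_id (K : fieldType) (A B : lmodType K) (t : tens A B) :
  tmap idfun idfun t = t.
Proof.
elim/tens_ind: t => [|a b|s t Hs Ht]; rewrite ?linear0 ?tmapE //.
by rewrite !linearD /= Hs Ht.
Qed.

Lemma eq_tmap (K : fieldType) (A B A' B' : lmodType K)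
    (u u' : A -> A') (v v' : B -> B') : u =1 u' -> v =1 v' -> tmap u v =1 tmap u' v'.
Proof. by move=> uu' vv' t; apply: eq_bigr => p _; rewrite uu' vv'. Qed.

Section LegSubspaces.
Variables (K : fieldType) (A B : lmodType K).
Implicit Types (U : set A) (W : set B) (t : tens A B).

(* membership in U ⊗ B and in A ⊗ W, see [in_legs_sum] *)
Definition in_left U t := forall g : {scalar B}, U (rslice g t).
Definition in_right W t := forall f : {scalar A}, W (lslice f t).

Lemma subspace_in_left U : subspace U -> subspace (in_left U).
Proof.
move=> sU; split=> [g|c s t Us Ut g]; first by rewrite linear0; case: sU.
by rewrite linearP; apply: (sU.2 _ _ _ (Us g) (Ut g)).
Qed.

Lemma subspace_in_right W : subspace W -> subspace (in_right W).
Proof.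
move=> sW; split=> [f|c s t Ws Wt f]; first by rewrite linear0; case: sW.
by rewrite linearP; apply: (sW.2 _ _ _ (Ws f) (Wt f)).
Qed.

Lemma in_left_tn U a b : subspace U -> U a -> in_left U (a ⊗ b).
Proof. by move=> sU Ua g; rewrite rslice_tn; apply: subspaceZ. Qed.
Lemma in_right_tn W a b : subspace W -> W b -> in_right W (a ⊗ b).
Proof. by move=> sW Wb f; rewrite lslice_tn; apply: subspaceZ. Qed.

Lemma in_rightP W t : subspace W ->
  (forall g : {scalar B}, (forall w, W w -> g w = 0) -> rslice g t = 0) ->
  in_right W t.
Proof.
move=> sW Wt f; apply: subspace_by_functionals => // g gW.
by rewrite slice_exchange Wt // linear0.
Qed.

Lemma in_leftP U t : subspace U ->
  (forall f : {scalar A}, (forall a, U a -> f a = 0) -> lslice f t = 0) ->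
  in_left U t.
Proof.
move=> sU Ut g; apply: subspace_by_functionals => // f fU.
by rewrite -slice_exchange Ut // linear0.
Qed.

(** Projections [u] and [w] onto U and W fix t, since the slices of t already lie in U and W.
    Applying them to any representation of t puts both factors of each term into place at once. *)
Lemma in_legs_sum U W t : subspace U -> subspace W ->
  in_left U t -> in_right W t -> exists2 s : seq (A * B),
    t = \sum_(p <- s) p.1 ⊗ p.2 & forall p, p \in s -> U p.1 /\ W p.2.
Proof.
move=> sU sW Ut Wt.
have [u [uU u_id]] := projection_exists sU.
have [w [wW w_id]] := projection_exists sW.
exists [seq (u p.1, w p.2) | p <- trepr t]; last first.
  by move=> _ /mapP[p _ ->]; split; [apply: uU|apply: wW].
have uwt : tmap u w t = t.
  have tE : tmap u idfun t = t.
    by apply: rslice_inj => g; rewrite rslice_tmap u_id.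
  rewrite -[RHS](_ : tmap idfun w t = t).
    by rewrite -{2}tE tmap_comp.
  by apply: lslice_inj => f; rewrite lslice_tmap w_id.
rewrite big_map -[LHS]uwt {1}(tensE t) linear_sum.
by apply: eq_bigr => p _; rewrite /= tmapE.
Qed.

Lemma in_left_sum U t : subspace U -> in_left U t ->
  exists2 s : seq (A * B),
    t = \sum_(p <- s) p.1 ⊗ p.2 & forall p, p \in s -> U p.1.
Proof.
move=> sU Ut; have [//|//|s -> sUW] := @in_legs_sum U setT t sU _ Ut.
by exists s => // p /sUW[].
Qed.

End LegSubspaces.

(** * Multipliers of tensor products *)

Section TensorLinear.
Variables (K : fieldType) (A B D : lmodType K).

HB.instance Definition _ (a : A) :=
  GRing.isLinear.Build K B (tens A B) *:%R (tn a) ((tn_bilin A B).2 a).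

Definition tnr (b : B) (a : A) : tens A B := a ⊗ b.
HB.instance Definition _ (b : B) :=
  GRing.isLinear.Build K A (tens A B) *:%R (tnr b) ((tn_bilin A B).1 b).

HB.instance Definition _ :=
  GRing.isLinear.Build K _ _ *:%R (@tassoc K A B D)
    (tlift_linear (tassoc_bilin A B D)).

Lemma lslice_tassoc (f : {scalar A}) t :
  lslice f (tassoc t) = tmap (lslice f) (idfun : {linear D -> D}) t :> tens B D.
Proof.
elim/tens_ind: t => [|s d|s t Hs Ht]; first by rewrite !linear0.
  elim/tens_ind: s => [|a b|s t Hs Ht].
  - by rewrite tmapE linear0 !tn0l !linear0.
  - by rewrite tassoc_tn tmapE /= !lslice_tn tnZl.
  - by rewrite !tnDl !linearD /= Hs Ht.
by rewrite !linearD /= Hs Ht.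
Qed.

Lemma rslice_tassoc (g : {scalar D}) t :
  tmap (idfun : {linear A -> A}) (rslice g) (tassoc t) = rslice g t :> tens A B.
Proof.
elim/tens_ind: t => [|s d|s t Hs Ht]; first by rewrite !linear0.
  elim/tens_ind: s => [|a b|s t Hs Ht].
  - by rewrite !tn0l !linear0.
  - by rewrite tassoc_tn tmapE /= !rslice_tn tnZr.
  - by rewrite !tnDl !linearD /= Hs Ht.
by rewrite !linearD /= Hs Ht.
Qed.

Lemma eq_lslice (f g : {scalar A}) (t : tens A B) :
  f =1 g -> lslice f t = lslice g t.
Proof. by move=> fg; apply: eq_bigr => p _; rewrite fg. Qed.

End TensorLinear.

Section StarAlgebras.
Variables (K : numClosedFieldType) (A : starAlgType K).

Lemma amul0l (a : A) : 0 ** a = 0.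
Proof. by have := amulZl 0 0 a; rewrite !scale0r. Qed.
Lemma amul0r (a : A) : a ** 0 = 0.
Proof. by have := amulZr 0 a 0; rewrite !scale0r. Qed.
Lemma amul_suml I (r : seq I) (F : I -> A) a :
  (\sum_(i <- r) F i) ** a = \sum_(i <- r) F i ** a.
Proof. exact: (linear_sum (mR (embed a))). Qed.
Lemma amulBl (a b c : A) : (a - b) ** c = a ** c - b ** c.
Proof. exact: (linearB (mR (embed c))). Qed.
Lemma amulBr (a b c : A) : a ** (b - c) = a ** b - a ** c.
Proof. exact: (linearB (mL (embed a))). Qed.

Lemma star0 : star (0 : A) = 0.
Proof.
have := star_antilinear (- 1) (0 : A) 0.
by rewrite rmorphN rmorph1 !scaleN1r oppr0 addr0 addNr.
Qed.
Lemma starD (a b : A) : star (a + b) = star a + star b.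
Proof. by have := star_antilinear 1 a b; rewrite rmorph1 !scale1r. Qed.
Lemma starZ c (a : A) : star (c *: a) = c^* *: star a.
Proof. by have := star_antilinear c a 0; rewrite star0 !addr0. Qed.
Lemma star_sum I (r : seq I) (F : I -> A) :
  star (\sum_(i <- r) F i) = \sum_(i <- r) star (F i).
Proof. by elim/big_rec2: _ => [|i x y _ <-]; rewrite ?star0 ?starD. Qed.

Lemma embed_inj : nondegenerate A -> injective (@embed K A).
Proof.
move=> [lA _] a b ab; apply/eqP; rewrite -subr_eq0; apply/eqP/lA => c.
have -> : (a - b) ** c = mL (embed a) c - mL (embed b) c.
  by rewrite -[LHS]/(mR (embed c) (a - b)) linearB.
by rewrite ab subrr.
Qed.

Lemma mL_embed (a b : A) : mL (embed a) b = a ** b.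
Proof. by []. Qed.
Lemma mR_embed (a b : A) : mR (embed a) b = b ** a.
Proof. by []. Qed.

Lemma embed_mL (x : mult A) a : embed (mL x a) = x * embed a.
Proof. by apply: multP => b /=; rewrite ?mL_mul ?mLR. Qed.
Lemma embed_mR (x : mult A) a : embed (mR x a) = embed a * x.
Proof. by apply: multP => b /=; rewrite ?mR_mul ?mLR. Qed.
Lemma embedM (a b : A) : embed (a ** b) = embed a * embed b.
Proof. by apply: multP => c /=; rewrite amulA. Qed.

HB.instance Definition _ :=
  GRing.isLinear.Build K A (mult A) *:%R (@embed K A) (@embed_linear K A).

Lemma mLD (x : mult A) a b : mL x (a + b) = mL x a + mL x b.
Proof. exact: linearD. Qed.
Lemma mRD (x : mult A) a b : mR x (a + b) = mR x a + mR x b.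
Proof. exact: linearD. Qed.

Lemma mL_lincomb k (x y : mult A) a : mL (k *: x + y) a = k *: mL x a + mL y a.
Proof. by []. Qed.
Lemma mR_lincomb k (x y : mult A) a : mR (k *: x + y) a = k *: mR x a + mR y a.
Proof. by []. Qed.

Lemma mL_sum (x : mult A) I (r : seq I) (F : I -> A) :
  mL x (\sum_(i <- r) F i) = \sum_(i <- r) mL x (F i).
Proof. exact: linear_sum. Qed.
Lemma mR_sum (x : mult A) I (r : seq I) (F : I -> A) :
  mR x (\sum_(i <- r) F i) = \sum_(i <- r) mR x (F i).
Proof. exact: linear_sum. Qed.

Lemma mL_mstar (x : mult A) a : mL (mstar x) a = star (mR x (star a)).
Proof. by []. Qed.
Lemma mR_mstar (x : mult A) a : mR (mstar x) a = star (mL x (star a)).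
Proof. by []. Qed.

Lemma mstarM (x y : mult A) : mstar (x * y) = mstar y * mstar x.
Proof. by apply: multP => a /=; rewrite !starK. Qed.
Lemma embed_star (a : A) : embed (star a) = mstar (embed a).
Proof. by apply: multP => b /=; rewrite starM starK. Qed.

End StarAlgebras.

Section TensorStarAlgebras.
Variables (K : numClosedFieldType) (A B : starAlgType K).

Lemma tens_mul (a c : A) (b d : B) : (a ⊗ b) ** (c ⊗ d) = (a ** c) ⊗ (b ** d).
Proof. exact: tmul_tn. Qed.
Lemma tens_star (a : A) (b : B) : star (a ⊗ b) = star a ⊗ star b.
Proof. exact: tstar_tn. Qed.

Lemma tens_mulr (t : tens A B) a b :
  t ** (a ⊗ b) = tmap (mR (embed a)) (mR (embed b)) t.
Proof.
elim/tens_ind: t => [|c d|s t Hs Ht]; first by rewrite amul0l linear0.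
  by rewrite tens_mul tmapE.
by rewrite amulDl Hs Ht linearD.
Qed.

Lemma tens_mull (t : tens A B) a b :
  (a ⊗ b) ** t = tmap (mL (embed a)) (mL (embed b)) t.
Proof.
elim/tens_ind: t => [|c d|s t Hs Ht]; first by rewrite amul0r linear0.
  by rewrite tens_mul tmapE.
by rewrite amulDr Hs Ht linearD.
Qed.

(** The factors are tested one at a time: multiplication by a is absorbed into the functional on the
    first leg, and the resulting slice in B is killed by every b. *)
Lemma tens_nondegenerate :
  nondegenerate A -> nondegenerate B -> nondegenerate (tens A B).
Proof.
move=> [lA rA] [lB rB]; split=> t t0; apply: rslice_eq0 => g.
  apply: lA => a; apply: functionals_separate => f; rewrite linear0.
  have := slice_exchange (f \o mR (embed a) : {scalar A}) g t => /= <-.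
  rewrite (lB (lslice _ t)) ?linear0 // => b.
  by rewrite -[_ ** b]/(mR (embed b) _) -lslice_tmap -tens_mulr t0 linear0.
apply: rA => a; apply: functionals_separate => f; rewrite linear0.
have := slice_exchange (f \o mL (embed a) : {scalar A}) g t => /= <-.
rewrite (rB (lslice _ t)) ?linear0 // => b.
by rewrite -[b ** _]/(mL (embed b) _) -lslice_tmap -tens_mull t0 linear0.
Qed.

Lemma mtensM (x x' : mult A) (y y' : mult B) :
  mtens x y * mtens x' y' = mtens (x * x') (y * y').
Proof. by apply: multP => t /=; rewrite tmap_comp. Qed.

Lemma mtens_embed (a : A) (b : B) : mtens (embed a) (embed b) = embed (a ⊗ b).
Proof. by apply: multP => t; rewrite /= ?tens_mull ?tens_mulr. Qed.

Lemma mL_mtens (x : mult A) (y : mult B) a b :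
  mL (mtens x y) (a ⊗ b) = mL x a ⊗ mL y b.
Proof. exact: tmapE. Qed.
Lemma mR_mtens (x : mult A) (y : mult B) a b :
  mR (mtens x y) (a ⊗ b) = mR x a ⊗ mR y b.
Proof. exact: tmapE. Qed.

Arguments mtens : simpl never.
Arguments mstar : simpl never.

Lemma mtens_star (x : mult A) (y : mult B) :
  mstar (mtens x y) = mtens (mstar x) (mstar y).
Proof.
apply: multP => t; elim/tens_ind: t => [|a b|s t Hs Ht].
- by rewrite !linear0.
- rewrite mL_mtens [LHS]mL_mstar (mL_mstar x) (mL_mstar y).
  by rewrite tens_star mR_mtens tens_star.
- by rewrite !mLD Hs Ht.
- by rewrite !linear0.
- rewrite mR_mtens [LHS]mR_mstar (mR_mstar x) (mR_mstar y).
  by rewrite tens_star mL_mtens tens_star.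
- by rewrite !mRD Hs Ht.
Qed.

End TensorStarAlgebras.
Arguments mtens : simpl never.
Arguments mstar : simpl never.
Arguments embed : simpl never.
Arguments legl : simpl never.
Arguments legr : simpl never.
Arguments embed_inj {K A} _ [x1 x2].

Section Legs.
Variables (K : numClosedFieldType) (A : starAlgType K).
Implicit Types (a b : A) (t : tens A A).

Lemma mstar1 : mstar (1 : mult A) = 1.
Proof. by apply: multP => a /=; rewrite starK. Qed.

Lemma legrM a b : legr (a ** b) = legr a * legr b.
Proof. by rewrite /legl /legr mtensM embedM mulr1. Qed.
Lemma legl_legr a b : legl a * legr b = embed (a ⊗ b).
Proof. by rewrite /legl /legr mtensM mulr1 mul1r mtens_embed. Qed.
Lemma legr_legl a b : legr b * legl a = embed (a ⊗ b).
Proof. by rewrite /legl /legr mtensM mulr1 mul1r mtens_embed. Qed.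
Lemma legC a b : legl a * legr b = legr b * legl a.
Proof. by rewrite legl_legr legr_legl. Qed.
Lemma legl_star a : mstar (legl a) = legl (star a).
Proof. by rewrite /legl /legr mtens_star -embed_star mstar1. Qed.
Lemma legr_star a : mstar (legr a) = legr (star a).
Proof. by rewrite /legl /legr mtens_star -embed_star mstar1. Qed.

Lemma mL_legl a b c : mL (legl a) (b ⊗ c) = (a ** b) ⊗ c.
Proof. by rewrite mL_mtens. Qed.
Lemma mL_legr a b c : mL (legr a) (b ⊗ c) = b ⊗ (a ** c).
Proof. by rewrite mL_mtens. Qed.
Lemma mR_legl a b c : mR (legl a) (b ⊗ c) = (b ** a) ⊗ c.
Proof. by rewrite mR_mtens. Qed.
Lemma mR_legr a b c : mR (legr a) (b ⊗ c) = b ⊗ (c ** a).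
Proof. by rewrite mR_mtens. Qed.

Section SliceLegs.
Variables (f : {scalar A}) (a : A) (t : tens A A).

Lemma lslice_mL_legl :
  lslice f (mL (legl a) t) = lslice (f \o mL (embed a) : {scalar A}) t.
Proof. exact: (lslice_tmap (mL (embed a)) (mL 1)). Qed.
Lemma lslice_mR_legl :
  lslice f (mR (legl a) t) = lslice (f \o mR (embed a) : {scalar A}) t.
Proof. exact: (lslice_tmap (mR (embed a)) (mR 1)). Qed.
Lemma lslice_mL_legr : lslice f (mL (legr a) t) = a ** lslice f t.
Proof. exact: (lslice_tmap (mL 1) (mL (embed a))). Qed.
Lemma lslice_mR_legr : lslice f (mR (legr a) t) = lslice f t ** a.
Proof. exact: (lslice_tmap (mR 1) (mR (embed a))). Qed.
Lemma rslice_mL_legr :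
  rslice f (mL (legr a) t) = rslice (f \o mL (embed a) : {scalar A}) t.
Proof. exact: (rslice_tmap (mL 1) (mL (embed a))). Qed.
Lemma rslice_mL_legl : rslice f (mL (legl a) t) = a ** rslice f t.
Proof. exact: (rslice_tmap (mL (embed a)) (mL 1)). Qed.
Lemma rslice_mR_legl : rslice f (mR (legl a) t) = rslice f t ** a.
Proof. exact: (rslice_tmap (mR (embed a)) (mR 1)). Qed.

End SliceLegs.

Lemma legl_cancell s t : nondegenerate A ->
  (forall a, mL (legl a) s = mL (legl a) t) -> s = t.
Proof.
move=> [_ rA] st; apply: rslice_inj => g; apply/eqP; rewrite -subr_eq0.
by apply/eqP/rA => a; rewrite amulBr -!rslice_mL_legl st subrr.
Qed.

Lemma legr_cancelr s t : nondegenerate A ->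
  (forall b, mR (legr b) s = mR (legr b) t) -> s = t.
Proof.
move=> [lA _] st; apply: lslice_inj => g; apply/eqP; rewrite -subr_eq0.
by apply/eqP/lA => a; rewrite amulBl -!lslice_mR_legr st subrr.
Qed.

End Legs.

(** * Coassociativity and the Galois maps *)

Section TensorAssociativity.
Variables (K : numClosedFieldType) (A B D : starAlgType K).

Lemma tassocM (s t : tens (tens A B) D) :
  tassoc (s ** t) = tassoc s ** tassoc t :> tens A (tens B D).
Proof.
elim/tens_ind: s => [|s d|s s' Hs Hs']; first by rewrite linear0 !amul0l linear0.
  elim/tens_ind: t => [|t d'|t t' Ht Ht']; first by rewrite linear0 !amul0r linear0.
    rewrite tens_mul.
    elim/tens_ind: s => [|a b|s s' Hs Hs'].
    - by rewrite amul0l !tn0l linear0 amul0l.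
    - elim/tens_ind: t => [|a' b'|t t' Ht Ht'].
      + by rewrite amul0r !tn0l linear0 amul0r.
      + by rewrite tens_mul !tassoc_tn !tens_mul.
      + by rewrite amulDr !tnDl !linearD /= Ht Ht' amulDr.
    - by rewrite amulDl !tnDl !linearD /= Hs Hs' amulDl.
  by rewrite amulDr !linearD /= Ht Ht' amulDr.
by rewrite amulDl !linearD /= Hs Hs' amulDl.
Qed.

End TensorAssociativity.

(** By non-degeneracy an element of A ⊗ (A ⊗ A) is determined by its products with elementary
    tensors, and these are values of [tassoc]. *)
Lemma assoc_eq_embed (K : numClosedFieldType) (A : starAlgType K)
    (s : tens (tens A A) A) (t : tens A (tens A A)) :
  nondegenerate A -> assoc_eq (embed s) (embed t) <-> tassoc s = t.
Proof.
move=> nd; split=> [st|<- u]; last by rewrite !tassocM.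
have nd3 := tens_nondegenerate nd (tens_nondegenerate nd nd).
apply/eqP; rewrite -subr_eq0; apply/eqP/nd3.1 => u.
suff: forall u, tassoc s ** u = t ** u by move=> E; rewrite amulBl E subrr.
elim/tens_ind => [|x yz|v w Hv Hw]; first by rewrite !amul0r.
  elim/tens_ind: yz => [|y z|v w Hv Hw].
  - by rewrite tn0r !amul0r.
  - by rewrite -tassoc_tn -tassocM; case: (st ((x ⊗ y) ⊗ z)).
  - by rewrite tnDr !amulDr Hv Hw.
by rewrite !amulDr Hv Hw.
Qed.

Section GaloisMaps.
Variables (K : numClosedFieldType) (A : starAlgType K).
Variable Delta : {linear A -> mult (tens A A)}.
Variables T1 T2 : {linear tens A A -> tens A A}.
Hypothesis nd : nondegenerate A.
Hypothesis T1E : forall a b, embed (T1 (a ⊗ b)) = Delta a * legr b.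
Hypothesis T2E : forall a b, embed (T2 (a ⊗ b)) = legl a * Delta b.

Let Delta_id_linear := GRing.isLinear.Build K _ _ *:%R (Delta_id Delta)
  (tlift_linear (Delta_id_bilin Delta)).
HB.instance Definition _ := Delta_id_linear.
Let id_Delta_linear := GRing.isLinear.Build K _ _ *:%R (id_Delta Delta)
  (tlift_linear (id_Delta_bilin Delta)).
HB.instance Definition _ := id_Delta_linear.

Lemma Delta_id_galois a s :
  mtens (legl a) 1 * Delta_id Delta s =
  embed (tmap (T2 \o tn a) (idfun : {linear A -> A}) s).
Proof.
elim/tens_ind: s => [|p q|s t Hs Ht].
- by rewrite !linear0 mulr0.
- rewrite [Delta_id _ _](tlift_tn _ _ (Delta_id_bilin Delta)).
  by rewrite tmapE -mtens_embed T2E mtensM mul1r.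
- by rewrite !linearD mulrDr /= Hs Ht.
Qed.

Lemma id_Delta_galois c t :
  id_Delta Delta t * mtens 1 (legr c) =
  embed (tmap (idfun : {linear A -> A}) (T1 \o tnr c) t).
Proof.
elim/tens_ind: t => [|p q|s t Hs Ht].
- by rewrite !linear0 mul0r.
- rewrite [id_Delta _ _](tlift_tn _ _ (id_Delta_bilin Delta)).
  by rewrite tmapE -mtens_embed T1E mtensM mulr1.
- by rewrite !linearD mulrDl /= Hs Ht.
Qed.

(* Van Daele's form of coassociativity: (T2 ⊗ id)(id ⊗ T1) = (id ⊗ T1)(T2 ⊗ id) *)
Lemma coassociativeP : coassociative Delta <-> forall a b c,
  tassoc (tmap (T2 \o tn a) (idfun : {linear A -> A}) (T1 (b ⊗ c))) =
  tmap (idfun : {linear A -> A}) (T1 \o tnr c) (T2 (a ⊗ b)).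
Proof.
have ndt := tens_nondegenerate nd nd.
split=> [co a b c|co a b c s t sE tE]; rewrite -?assoc_eq_embed //.
  by rewrite -Delta_id_galois -id_Delta_galois; apply: co; rewrite ?T1E ?T2E.
have -> : s = T1 (b ⊗ c) by apply: (embed_inj ndt); rewrite T1E.
have -> : t = T2 (a ⊗ b) by apply: (embed_inj ndt); rewrite T2E.
by rewrite Delta_id_galois id_Delta_galois assoc_eq_embed.
Qed.

End GaloisMaps.

(** * Counit and antipode *)

Section MultiplierHopfStar.
Variables (K : numClosedFieldType) (A : starAlgType K).
Variable Delta : {linear A -> mult (tens A A)}.
Variables T1 T1i T2 T2i : {linear tens A A -> tens A A}.
Hypothesis nd : nondegenerate A.
Hypothesis DeltaM : forall a b, Delta (a ** b) = Delta a * Delta b.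
Hypothesis Delta_star : forall a, Delta (star a) = mstar (Delta a).
Hypothesis T1E : forall a b, embed (T1 (a ⊗ b)) = Delta a * legr b.
Hypothesis T2E : forall a b, embed (T2 (a ⊗ b)) = legl a * Delta b.
Hypothesis T1K : cancel T1 T1i.
Hypothesis T1iK : cancel T1i T1.
Hypothesis T2K : cancel T2 T2i.
Hypothesis T2iK : cancel T2i T2.
Hypothesis coas : coassociative Delta.
Implicit Types (a b c d x y z : A) (s t u : tens A A) (f g w : {scalar A}).

Local Notation idA := (idfun : {linear A -> A}).

Let ndt := tens_nondegenerate nd nd.
Let einj := embed_inj ndt.

Lemma mL_Delta_T1 a b c : mL (Delta a) (T1 (b ⊗ c)) = T1 ((a ** b) ⊗ c).
Proof. by apply: einj; rewrite embed_mL !T1E DeltaM mulrA. Qed.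

Lemma mR_Delta_T2 a b c : mR (Delta a) (T2 (b ⊗ c)) = T2 (b ⊗ (c ** a)).
Proof. by apply: einj; rewrite embed_mR !T2E DeltaM mulrA. Qed.

Lemma mR_legr_T1 a b c : mR (legr c) (T1 (a ⊗ b)) = T1 (a ⊗ (b ** c)).
Proof. by apply: einj; rewrite embed_mR !T1E legrM mulrA. Qed.

Lemma mL_legl_T1 a b c : mL (legl a) (T1 (b ⊗ c)) = mR (legr c) (T2 (a ⊗ b)).
Proof. by apply: einj; rewrite embed_mL embed_mR T1E T2E mulrA. Qed.

Lemma mR_legl_T1 a b c : mR (legl c) (T1 (a ⊗ b)) = mL (Delta a) (c ⊗ b).
Proof. by apply: einj; rewrite embed_mR embed_mL T1E -mulrA legr_legl. Qed.

Lemma mL_legr_T2 a b c : mL (legr c) (T2 (a ⊗ b)) = mR (Delta b) (a ⊗ c).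
Proof. by apply: einj; rewrite embed_mL embed_mR T2E mulrA legr_legl. Qed.

(** The adjoint of (star b ⊗ 1)Δ(star a). Only [T1] and [T2] come with the definition of the
    algebra, whereas the right leg of Δ(h) is described by this third map. *)
Definition T3 a b : tens A A := star (T2 (star b ⊗ star a)).
Lemma T3E a b : embed (T3 a b) = Delta a * legl b.
Proof. by rewrite embed_star T2E mstarM legl_star starK -Delta_star starK. Qed.

Lemma T3Z k a b : T3 (k *: a) b = k *: T3 a b.
Proof. by rewrite /T3 starZ tnZr linearZ starZ conjCK. Qed.

Definition T4 a b : tens A A := star (T1 (star a ⊗ star b)).
Lemma T4E a b : embed (T4 a b) = legr b * Delta a.
Proof. by rewrite embed_star T1E mstarM legr_star starK -Delta_star starK. Qed.

Lemma mL_Delta_T3 a b c : mL (Delta a) (T3 b c) = T3 (a ** b) c.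
Proof. by apply: einj; rewrite embed_mL !T3E DeltaM mulrA. Qed.
Lemma mL_legl_T3 a b c : mL (legl a) (T3 b c) = mR (legl c) (T2 (a ⊗ b)).
Proof. by apply: einj; rewrite embed_mL embed_mR T3E T2E mulrA. Qed.
Lemma mR_legr_T3 a b c : mR (legr c) (T3 a b) = mR (legl b) (T1 (a ⊗ c)).
Proof. by apply: einj; rewrite !embed_mR T3E T1E -!mulrA legC. Qed.
Lemma mL_legl_T4 a b c : mL (legl a) (T4 b c) = mL (legr c) (T2 (a ⊗ b)).
Proof. by apply: einj; rewrite !embed_mL T4E T2E !mulrA legC. Qed.

Lemma T3_surjective t : exists r : seq (A * A), t = \sum_(p <- r) T3 p.1 p.2.
Proof.
pose u := T2i (star t); exists [seq (star p.2, star p.1) | p <- trepr u].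
have -> : t = star (T2 u) by rewrite T2iK starK.
rewrite big_map {1}(tensE u) linear_sum star_sum.
by apply: eq_bigr => p _; rewrite /T3 /= !starK.
Qed.

(** * The product map and the convolution operators *)

Definition mulm : tens A A -> A := tlift (@amul K A).
Lemma amul_bilin : bilin (@amul K A).
Proof. by split; [apply: amul_linearl|apply: amul_linearr]. Qed.
HB.instance Definition _ :=
  GRing.isLinear.Build K _ _ *:%R mulm (tlift_linear amul_bilin).
Lemma mulmE a b : mulm (a ⊗ b) = a ** b.
Proof. exact: (tlift_tn _ _ amul_bilin). Qed.

Lemma mulm_mL_legl a t : mulm (mL (legl a) t) = a ** mulm t.
Proof.
elim/tens_ind: t => [|b c|s t Hs Ht]; first by rewrite !linear0 amul0r.
  by rewrite mL_legl !mulmE amulA.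
by rewrite !(mLD, linearD) /= Hs Ht amulDr.
Qed.

(* ω(a x_(1)) x_(2) and x_(1) ω(x_(2) b) *)
Definition lconv a w : {linear A -> A} := lslice w \o T2 \o tn a.
Definition rconv b w : {linear A -> A} := rslice w \o T1 \o tnr b.

(** Coassociativity with ω applied to the first of the three legs. The inverse [T1i] then commutes
    with [lconv a w] too, which is how ε and S are reached without a formula for [T1i]. *)
Lemma lconv_T1 a w s : T1 (tmap (lconv a w) idA s) = tmap (lconv a w) idA (T1 s).
Proof.
elim/tens_ind: s => [|b c|s t Hs Ht]; first by rewrite !linear0.
  rewrite tmapE; have /(coassociativeP nd T1E T2E) := coas.
  move=> /(_ a b c)/(congr1 (lslice w)); rewrite lslice_tassoc tmap_comp.
  by rewrite lslice_tmap => ->.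
by rewrite !linearD /= Hs Ht.
Qed.

Lemma rconv_T2 b w s : T2 (tmap idA (rconv b w) s) = tmap idA (rconv b w) (T2 s).
Proof.
elim/tens_ind: s => [|a c|s t Hs Ht]; first by rewrite !linear0.
  rewrite tmapE; have /(coassociativeP nd T1E T2E) := coas.
  move=> /(_ a c b)/(congr1 (tmap idA (rslice w))); rewrite rslice_tassoc tmap_comp.
  by rewrite rslice_tmap.
by rewrite !linearD /= Hs Ht.
Qed.

Lemma lconv_T1i a w s :
  T1i (tmap (lconv a w) idA s) = tmap (lconv a w) idA (T1i s).
Proof. by apply: (can_inj T1K); rewrite lconv_T1 !T1iK. Qed.

Lemma lconv_rconv a w b f x : rconv b f (lconv a w x) = lconv a w (rconv b f x).
Proof.
have := lconv_T1 a w (x ⊗ b); rewrite tmapE => /(congr1 (rslice f)).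
by rewrite rslice_tmap.
Qed.

Lemma lconv_mR a w x c :
  lconv a w x ** c = lslice (w \o mL (embed a) : {scalar A}) (T1 (x ⊗ c)).
Proof. by rewrite -lslice_mL_legl mL_legl_T1 lslice_mR_legr. Qed.

Lemma T1i_lconv_mulm a w s :
  mulm (tmap (lconv a w) idA s) = lslice w (mL (legl a) (T1 s)).
Proof.
elim/tens_ind: s => [|b c|s t Hs Ht]; first by rewrite !linear0.
  by rewrite tmapE mulmE mL_legl_T1 lslice_mR_legr.
by rewrite [T1 _]linearD mLD !linearD /= Hs Ht.
Qed.

(** m(T1i(y ⊗ c)) is going to be ε(y)c; this computes it on y = ω(a b_(1)) b_(2), where [T1i] passes
    through the convolution. *)
Lemma mulm_T1i_lconv a w b c : mulm (T1i (lconv a w b ⊗ c)) = w (a ** b) *: c.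
Proof.
have := lconv_T1i a w (b ⊗ c); rewrite tmapE => ->.
by rewrite T1i_lconv_mulm T1iK mL_legl lslice_tn.
Qed.

Lemma mulm_T1i_T2 w s c : mulm (T1i (lslice w (T2 s) ⊗ c)) = w (mulm s) *: c.
Proof.
elim/tens_ind: s => [|a b|s t Hs Ht].
- by rewrite !linear0 tn0l !linear0 scale0r.
- by rewrite mulm_T1i_lconv mulmE.
- by rewrite !linearD tnDl !linearD /= Hs Ht scalerDl.
Qed.

(** * Construction of the counit and the antipode *)

Section Counit.
Variables (h : A) (w0 : {scalar A}).
Hypothesis w0h : w0 h = 1.

Lemma h_neq0 : h != 0.
Proof.
by apply/eqP => h0; move: w0h; rewrite h0 linear0 => /esym/eqP; rewrite oner_eq0.
Qed.

(** Writing h ⊗ y as [T2 s] shows y as the slice of [T2 s] by [w0], and on such a slice ε must be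
    [w0] of the product of s. At this point h is any vector normalised by [w0]. *)
Definition counit : {scalar A} := w0 \o (mulm \o T2i \o tn h).

Lemma counitZ k a : counit (k *: a) = k * counit a.
Proof. exact: linearZ. Qed.

Lemma mulm_T1i y c : mulm (T1i (y ⊗ c)) = counit y *: c.
Proof.
by rewrite -mulm_T1i_T2 T2iK lslice_tn w0h scale1r.
Qed.

Lemma counit_T1 s : lslice counit (T1 s) = mulm s.
Proof.
rewrite -{2}(T1K s); elim/tens_ind: (T1 s) => [|a b|u v Hu Hv].
- by rewrite !linear0.
- by rewrite mulm_T1i lslice_tn.
- by rewrite !linearD /= Hu Hv.
Qed.

Lemma counit_T2 s : rslice counit (T2 s) = mulm s.
Proof.
apply: functionals_separate => w; rewrite -slice_exchange.
have: (counit (lslice w (T2 s)) - w (mulm s)) *: h == 0.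
  by rewrite scalerBl -mulm_T1i mulm_T1i_T2 subrr.
by rewrite scaler_eq0 (negbTE h_neq0) orbF subr_eq0 => /eqP.
Qed.

Lemma counit_Delta a s : lslice counit (mL (Delta a) s) = a ** lslice counit s.
Proof.
rewrite -(T1iK s); elim/tens_ind: (T1i s) => [|b c|u v Hu Hv].
- by rewrite !linear0 amul0r.
- by rewrite mL_Delta_T1 !counit_T1 !mulmE amulA.
- by rewrite !(linearD, mLD) /= Hu Hv amulDr.
Qed.

(** The identity (ε ⊗ id)(u(x ⊗ y)) = ε(x) (ε ⊗ id)(u) y is checked on the range of T1, which is
    everything: there u(x ⊗ y) is some Δ(c)(x ⊗ dy). With u = a ⊗ q, x = b, y = r it is
    multiplicativity times q r, so a nonzero product q r is chosen. *)
Lemma counitM a b : counit (a ** b) = counit a * counit b.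
Proof.
have E u r q : lslice counit (u ** (r ⊗ q)) = counit r *: (lslice counit u ** q).
  rewrite -(T1iK u); elim/tens_ind: (T1i u) => [|c d|v v' Hv Hv'].
  - by rewrite linear0 amul0l !linear0 amul0l scaler0.
  - have -> : T1 (c ⊗ d) ** (r ⊗ q) = mL (Delta c) (r ⊗ (d ** q)).
      rewrite -mR_legl_T1 -mR_legr_T1; apply: einj.
      by rewrite embedM !embed_mR -legr_legl mulrA.
    by rewrite counit_Delta counit_T1 mulmE lslice_tn amulZr amulA.
  - by rewrite linearD amulDl !linearD /= Hv Hv' amulDl scalerDr.
have [[c c0]|A0] := EM (exists c, c != 0); last first.
  have z0 x : x = 0 by apply: contrapT => /eqP h'; apply: A0; exists x.
  by rewrite [a]z0 amul0l linear0 mul0r.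
have [q [r qr0]] : exists q r : A, q ** r != 0.
  apply: contrapT => nqr; case/eqP: c0; apply: nd.1 => r.
  by apply: contrapT => /eqP cr; apply: nqr; exists c, r.
have := E (a ⊗ q) b r; rewrite tens_mul !lslice_tn amulZl scalerA => /eqP.
by rewrite -subr_eq0 -scalerBl scaler_eq0 (negbTE qr0) orbF subr_eq0 mulrC => /eqP.
Qed.

(* [antip (a ⊗ b)] is S(a)b *)
Definition antip : {linear tens A A -> A} := lslice counit \o T1i.

Lemma antip_T1 s : antip (T1 s) = lslice counit s.
Proof. by rewrite /= T1K. Qed.

(** This carries S(a_(1)) a_(2) = ε(a). On the range of T1, Δ(a) multiplies the first argument by a,
    and ε is multiplicative; antimultiplicativity of S follows from it. *)
Lemma antip_Delta a s : antip (mL (Delta a) s) = counit a *: antip s.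
Proof.
rewrite -(T1iK s); elim/tens_ind: (T1i s) => [|b c|u v Hu Hv].
- by rewrite !linear0.
- by rewrite mL_Delta_T1 !antip_T1 !lslice_tn counitM scalerA.
- by rewrite [T1 _]linearD mLD !linearD Hu Hv.
Qed.

Lemma antip_mR_legl y s : antip (mR (legl y) s) = antip (y ⊗ antip s).
Proof.
rewrite -(T1iK s); elim/tens_ind: (T1i s) => [|b c|u v Hu Hv].
- by rewrite !linear0.
- by rewrite mR_legl_T1 antip_Delta antip_T1 lslice_tn tnZr linearZ.
- by rewrite [T1 _]linearD mRD !linearD Hu Hv.
Qed.

Lemma antip_antimul x y b : antip ((x ** y) ⊗ b) = antip (y ⊗ antip (x ⊗ b)).
Proof. by rewrite -mR_legl antip_mR_legl. Qed.

(** In Sweedler form T1i(z ⊗ b) = z_(1) ⊗ S(z_(2)) b, with the first leg covered by c. It holds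
    because [T1i] commutes with [lconv c w] and [antip] is ε after [T1i]. *)
Lemma antip_T2 c z b :
  tmap idA (antip \o tnr b) (T2 (c ⊗ z)) = mL (legl c) (T1i (z ⊗ b)).
Proof.
apply: lslice_inj => w; rewrite lslice_tmap lslice_mL_legl.
have := lconv_T1i c w (z ⊗ b); rewrite tmapE /= => ->.
rewrite -[lslice _ (tmap (lconv _ _) _ _)]/(lslice counit (tmap (lconv c w) idA _)).
rewrite lslice_tmap; apply: eq_lslice => y.
by rewrite -[RHS]/(w (c ** y)) -mulmE -counit_T2 -slice_exchange.
Qed.

Lemma mulm_antip_T2 c z b :
  mulm (tmap idA (antip \o tnr b) (T2 (c ⊗ z))) = counit z *: (c ** b).
Proof. by rewrite antip_T2 mulm_mL_legl mulm_T1i amulZr. Qed.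

(** z_(1) S(a z_(2)) b = z_(1) S(z_(2)) S(a) b, where a covers the second leg and a left factor c is
    added to reach T2. For z = h it will exhibit S(a) b as an element of CA. *)
Lemma mulm_antip_T4 z a b :
  mulm (tmap idA (antip \o tnr b) (T4 z a)) = counit z *: antip (a ⊗ b).
Proof.
apply/eqP; rewrite -subr_eq0; apply/eqP/nd.2 => c; rewrite amulBr -mulm_mL_legl.
have tE s : mL (legl c) (tmap idA (antip \o tnr b) s) =
    tmap idA (antip \o tnr b) (mL (legl c) s).
  elim/tens_ind: s => [|x y|u v Hu Hv]; first by rewrite !linear0.
    by rewrite tmapE !mL_legl tmapE.
  by rewrite tmapD !mLD Hu Hv tmapD.
rewrite tE mL_legl_T4; set t := tmap _ _ _.
have -> : t = tmap idA (antip \o tnr (antip (a ⊗ b))) (T2 (c ⊗ z)); last first.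
  by rewrite mulm_antip_T2 amulZr subrr.
rewrite {}/t; elim/tens_ind: (T2 _) => [|x y|u v Hu Hv]; first by rewrite !linear0.
  by rewrite mL_legr !tmapE; congr (_ ⊗ _); apply: antip_antimul.
by rewrite mLD !tmapD Hu Hv.
Qed.

(** * The legs of a group-like projection *)

Section GroupLike.
Hypothesis hh : h ** h = h.
Hypothesis hstar : star h = h.
Hypothesis h_grouplike : Delta h * legr h = embed (h ⊗ h).
Variable C : set A.
Hypothesis sC : subspace C.
Hypothesis C_right : forall f b, C (lslice f (T3 h b)).
Hypothesis C_right_min : forall W, subspace W ->
  (forall f b, W (lslice f (T3 h b))) -> C `<=` W.
Hypothesis C_left : forall g b, C (rconv b g h).
Hypothesis C_left_min : forall W, subspace W ->
  (forall g b, W (rconv b g h)) -> C `<=` W.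
Local Notation eps := counit.

(** If g vanishes on W, then a (id ⊗ g)(t) = 0 for every a in S, hence (id ⊗ g)(t) = 0. The set S is
    taken to be all of A and, for closure under products, C itself. *)
Lemma in_right_cancel_mL (S W : set A) t : subspace W ->
  (forall y, (forall a, S a -> a ** y = 0) -> y = 0) ->
  (forall a, S a -> in_right W (mL (legl a) t)) -> in_right W t.
Proof.
move=> sW Snd SW; apply: in_rightP => // g gW; apply: Snd => a Sa.
rewrite -rslice_mL_legl; apply: functionals_separate => f.
by rewrite -slice_exchange linear0 gW //; apply: (SW a Sa f).
Qed.

Lemma in_right_cancel_mR W t : subspace W ->
  (forall a, in_right W (mR (legl a) t)) -> in_right W t.
Proof.
move=> sW Wt; apply: in_rightP => // g gW; apply: nd.1 => a.
rewrite -rslice_mR_legl; apply: functionals_separate => f.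
by rewrite -slice_exchange linear0 gW //; apply: (Wt a f).
Qed.

Lemma in_left_cancel_mR W t : subspace W ->
  (forall b, in_left W (mR (legr b) t)) -> in_left W t.
Proof.
move=> sW Wt; apply: in_leftP => // g gW; apply: nd.1 => a.
rewrite -lslice_mR_legr; apply: functionals_separate => f.
by rewrite slice_exchange linear0 gW //; apply: (Wt a f).
Qed.

Lemma nd_setT y : (forall a, [set: A] a -> a ** y = 0) -> y = 0.
Proof. by move=> y0; apply: nd.2 => a; apply: y0. Qed.

(** (a ⊗ 1)Δ(h) and Δ(h)(b ⊗ 1) have the same right leg: both are compared with (a ⊗ 1)Δ(h)(b ⊗ 1),
    where b, respectively a, cancels. *)
Lemma C_lconv a f : C (lconv a f h).
Proof.
apply: (in_right_cancel_mR (t := T2 (a ⊗ h)) sC) => b g.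
by rewrite -mL_legl_T3 lslice_mL_legl.
Qed.

Lemma C_lconv_min W : subspace W -> (forall a f, W (lconv a f h)) -> C `<=` W.
Proof.
move=> sW Wl; apply: C_right_min => // f b; move: f.
apply: (in_right_cancel_mL (S := setT) sW nd_setT) => a _ f.
rewrite mL_legl_T3 lslice_mR_legl.
exact: (Wl a (f \o mR (embed b) : {scalar A})).
Qed.

Lemma T1_hh : T1 (h ⊗ h) = h ⊗ h.
Proof. by apply: einj; rewrite T1E. Qed.

Lemma counit_h : eps h = 1.
Proof.
have := counit_T1 (h ⊗ h); rewrite T1_hh lslice_tn mulmE hh => /eqP.
rewrite -[X in _ == X]scale1r -subr_eq0 -scalerBl scaler_eq0.
by rewrite (negbTE h_neq0) orbF subr_eq0 => /eqP.
Qed.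

Lemma scaled_h c k : c ** h = k *: h -> c ** h = eps c *: h.
Proof.
move=> E; rewrite E; congr (_ *: _); move/(congr1 eps): E.
by rewrite counitM counitZ counit_h !mulr1.
Qed.

(** On a generator ω(a h_(1)) h_(2) right multiplication by h gives ω(ah) h; applying ε, with ε(h) =
    1, identifies the scalar. *)
Lemma C_mul_h c : C c -> c ** h = eps c *: h.
Proof.
pose W : set A := fun c => c ** h = eps c *: h.
have sW : subspace W.
  split=> [|k x y xE yE]; rewrite /W; first by rewrite amul0l linear0 scale0r.
  by rewrite amulDl amulZl xE yE linearP scalerDl scalerA.
apply: (C_lconv_min (W := W) sW) => a f; apply: (@scaled_h _ (f (a ** h))).
rewrite -lslice_mR_legr -mL_legl_T1 T1_hh mL_legl lslice_tn //.
Qed.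

Definition conj_functional f : {scalar A}.
Proof.
apply: (@to_scalar _ _ (fun a => (f (star a))^*)) => c x y.
by rewrite star_antilinear (linearP f) rmorphD rmorphM /= conjCK.
Defined.

Lemma star_lslice f t : star (lslice f t) = lslice (conj_functional f) (star t).
Proof.
elim/tens_ind: t => [|a b|s t Hs Ht]; first by rewrite star0 !linear0 star0.
  by rewrite tens_star !lslice_tn starZ /= /bundled_scalar /= starK.
by rewrite !(starD, linearD) /= Hs Ht.
Qed.

Lemma C_star c : C c -> C (star c).
Proof.
pose W : set A := fun c => C (star c).
have sW : subspace W.
  split=> [|k x y Wx Wy]; first by rewrite /W /= star0; case: sC.
  by rewrite /W /= star_antilinear; apply: sC.2.
apply: (C_right_min (W := W) sW) => f b.
rewrite /W /= star_lslice starK hstar.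
exact: C_lconv.
Qed.

Lemma h_mul_C c : C c -> h ** c = eps c *: h.
Proof.
move=> Cc; have := C_mul_h (C_star Cc) => /(congr1 star).
rewrite starM starK starZ hstar => E; rewrite E; congr (_ *: _).
move/(congr1 eps): E.
by rewrite counitM counitZ counit_h mul1r mulr1.
Qed.

(* Comparing the two descriptions of C: for c = h_(1) ω(h_(2) b) the relation
   ch = ε(c)h reads (id ⊗ ω)(Δ(h)(h ⊗ b)) = ω(hb)h. *)
Lemma T2_hh : T2 (h ⊗ h) = h ⊗ h.
Proof.
have E b : mR (legl h) (T1 (h ⊗ b)) = h ⊗ (h ** b).
  apply: rslice_inj => g; rewrite rslice_mR_legl rslice_tn.
  by rewrite (C_mul_h (C_left g b)) -slice_exchange counit_T1 mulmE.
suff T3hh : T3 h h = h ⊗ h.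
  by rewrite -[T2 _]starK -{1 2}hstar -/(T3 h h) T3hh tens_star hstar.
by apply: legr_cancelr => // b; rewrite mR_legr_T3 E mR_legr.
Qed.

Lemma T4_h_in_left a : in_left C (T4 h a).
Proof.
apply: in_left_cancel_mR => // b g.
suff -> : mR (legr b) (T4 h a) = mL (legr a) (T1 (h ⊗ b)).
  by rewrite rslice_mL_legr; apply: C_left.
by apply: einj; rewrite embed_mR embed_mL T4E T1E mulrA.
Qed.

(* CA = A, by h_(1) S(h_(2)) = ε(h) *)
Lemma C_mul_spans W : subspace W ->
  (forall c a, C c -> W (c ** a)) -> forall a, W a.
Proof.
move=> sW CW a.
have -> : a = antip (T1 (h ⊗ a)) by rewrite antip_T1 lslice_tn counit_h scale1r.
elim/tens_ind: (T1 _) => [|y b|s t Ws Wt]; first by rewrite linear0; case: sW.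
  rewrite -[antip _]scale1r -counit_h -mulm_antip_T4.
  have [s -> sCs] := in_left_sum sC (T4_h_in_left y).
  rewrite tmap_sum linear_sum big_seq.
  elim/big_ind: _ => [|u v|p ps]; first by case: sW.
    exact: subspaceD.
  rewrite tmapE -[X in W X]/(mulm (p.1 ⊗ antip (p.2 ⊗ b))) mulmE.
  by apply: CW; apply: sCs.
by rewrite linearD; apply: subspaceD.
Qed.

(** The involution turns cy = 0 into (star y)(star c) = 0, so star y kills CA, which is A. *)
Lemma C_cancel y : (forall c, C c -> c ** y = 0) -> y = 0.
Proof.
move=> Cy; apply: (can_inj (@starK K A)); rewrite star0; apply: nd.1.
apply: C_mul_spans => [|c a Cc].
  split=> [|k a b aE bE]; first by rewrite amul0r.
  by rewrite amulDr amulZr aE bE scaler0 addr0.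
by rewrite amulA -[c]starK -starM Cy ?star0 ?amul0l //; apply: C_star.
Qed.

(** Both sides are w(a' x_(1)) r(a x_(2)) x_(3). Writing a' ⊗ a as a sum of terms (p ⊗ 1)Δ(q) merges
    the two coefficients into r(w(p y_(1)) y_(2)) with y = q x_(1). Composites of these operators
    are thus sums of such operators, and C, the span of their values at h, is stable. *)
Lemma lconv_lconv a r a' w x : lconv a r (lconv a' w x) =
  \sum_(p <- trepr (T2i (a' ⊗ a))) lconv p.2 (r \o lconv p.1 w : {scalar A}) x.
Proof.
apply/eqP; rewrite -subr_eq0; apply/eqP/nd.1 => c.
apply/eqP; rewrite amulBl subr_eq0; apply/eqP.
rewrite lconv_mR amul_suml.
under eq_bigr => p _ do rewrite lconv_mR.
have := lconv_T1 a' w (x ⊗ c); rewrite tmapE => ->.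
rewrite lslice_tmap.
rewrite /lslice /tlift /tsum exchange_big /=; apply: eq_bigr => q _.
rewrite -scaler_suml; congr (_ *: _).
rewrite /= -lslice_mL_legr mL_legr_T2.
pose F : {scalar tens A A} := r \o (lslice w \o mR (Delta q.1) \o T2).
rewrite -{1}[a' ⊗ a]T2iK -[LHS]/(F (T2i (a' ⊗ a))).
rewrite {1}(tensE (T2i _)) (linear_sum F).
by apply: eq_bigr => p _; rewrite /= mR_Delta_T2.
Qed.

Lemma lconv_C a f c : C c -> C (lconv a f c).
Proof.
pose W : set A := fun c => C (lconv a f c).
have sW : subspace W.
  split=> [|k x y Wx Wy]; rewrite /W; first by rewrite linear0; case: sC.
  by rewrite linearP; apply: sC.2.
apply: (C_lconv_min (W := W) sW) => a' g; rewrite /W lconv_lconv.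
elim/big_ind: _ => [|u v|p _]; first by case: sC.
  exact: subspaceD.
exact: C_lconv.
Qed.

(** The two descriptions of C meet here: on ω(a h_(1)) h_(2) the commuting operators are exchanged,
    so that [rconv] acts on h and lands in the left leg. *)
Lemma rconv_C b g c : C c -> C (rconv b g c).
Proof.
pose W : set A := fun c => C (rconv b g c).
have sW : subspace W.
  split=> [|k x y Wx Wy]; rewrite /W; first by rewrite linear0; case: sC.
  by rewrite linearP; apply: sC.2.
apply: (C_lconv_min (W := W) sW) => a f; rewrite /W lconv_rconv.
exact: lconv_C.
Qed.

(* the elements of C ⊗ C, see [in_legs_sum] *)
Definition CC t := in_left C t /\ in_right C t.

Lemma subspace_CC : subspace CC.
Proof.
have sl := subspace_in_left A sC; have sr := subspace_in_right A sC.
split=> [|k s t [sl1 sr1] [tl tr]]; first by split; [apply: sl.1|apply: sr.1].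
by split; [apply: sl.2|apply: sr.2].
Qed.

Lemma CC_tn c d : C c -> C d -> CC (c ⊗ d).
Proof. by move=> Cc Cd; split; [apply: in_left_tn|apply: in_right_tn]. Qed.

Lemma CC_ind (P : tens A A -> Prop) : subspace P ->
  (forall c d, C c -> C d -> P (c ⊗ d)) -> CC `<=` P.
Proof.
move=> sP PC t [tl tr]; have [s -> sCs] := in_legs_sum sC sC tl tr.
rewrite big_seq; elim/big_ind: _ => [|u v|p /sCs[]]; first by case: sP.
  exact: subspaceD.
exact: PC.
Qed.

(** * Preimages of C ⊗ C under the Galois maps *)

Lemma rconv_mul b w x z (s : seq (A * A)) : T1 (z ⊗ b) = \sum_(p <- s) p.1 ⊗ p.2 ->
  rconv b w (x ** z) = \sum_(p <- s) rconv p.2 w x ** p.1.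
Proof.
move=> sE; rewrite /= -mL_Delta_T1 sE !linear_sum; apply: eq_bigr => p _.
by rewrite /= -rslice_mR_legl mR_legl_T1.
Qed.

Lemma lconv_mul a w x z (s : seq (A * A)) : T2 (a ⊗ z) = \sum_(p <- s) p.1 ⊗ p.2 ->
  lconv a w (z ** x) = \sum_(p <- s) p.2 ** lconv p.1 w x.
Proof.
move=> sE; rewrite /= -mR_Delta_T2 sE !linear_sum; apply: eq_bigr => p _.
by rewrite /= -lslice_mL_legr mL_legr_T2.
Qed.

Lemma T1_preimage_h b g : exists2 s, CC s & h ⊗ rconv b g h = T1 s.
Proof.
have hb_left : in_left C (T1 (h ⊗ b)) by move=> f; apply: C_left.
have [s sE sCs] := in_left_sum sC hb_left.
(* With Δ(h)(1 ⊗ b) = Σ p.1 ⊗ p.2, T1 of this witness is Σ h_(1) ⊗ h_(2) p.1 g(h_(3) p.2), that is,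
   id ⊗ [rconv b g] applied to Δ(h)(1 ⊗ h) = h ⊗ h. *)
exists (\sum_(p <- s) rconv p.2 g h ⊗ p.1).
  rewrite big_seq; elim/big_ind: _ => [|u v|p /sCs Cp]; first exact: subspace_CC.1.
    exact: (subspaceD subspace_CC).
  exact: CC_tn.
(* The left factor a ⊗ 1 trades T1 for T2, which commutes with [rconv] in the second leg. *)
apply: legl_cancell => // a; rewrite mL_legl [T1 _]linear_sum mL_sum.
under eq_bigr => p _.
  rewrite mL_legl_T1; have := rconv_T2 p.2 g (a ⊗ h); rewrite tmapE => ->; over.
have -> : (a ** h) ⊗ rconv b g h =
    tmap idA (rconv b g \o mR (embed h)) (T2 (a ⊗ h)).
  rewrite -[RHS](tmap_comp idA (mR (embed h)) idA (rconv b g)).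
  rewrite -[tmap idA (mR (embed h)) _]/(mR (legr h) _).
  by rewrite -mL_legl_T1 T1_hh mL_legl tmapE.
elim/tens_ind: (T2 _) => [|x y|u v Hu Hv].
- by rewrite linear0 big1 // => p _; rewrite !linear0.
- rewrite tmapE -[X in _ ⊗ X = _]/(rconv b g (y ** h)) (rconv_mul _ _ sE) tn_sumr.
  by apply: eq_bigr => p _; rewrite tmapE mR_legr.
- rewrite tmapD Hu Hv -big_split; apply: eq_bigr => p _.
  by rewrite tmapD mRD.
Qed.

Lemma T2_preimage_h a f : exists2 s, CC s & lconv a f h ⊗ h = T2 s.
Proof.
have ah_right : in_right C (T2 (a ⊗ h)) by move=> g; apply: C_lconv.
have [s sE sCs] := in_legs_sum (subspace_setT A) sC (fun=> I) ah_right.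
(* The mirror image: T2 of this witness is [lconv a f] ⊗ id applied to (h ⊗ 1)Δ(h), which is h ⊗ h
   by [T2_hh]. *)
exists (\sum_(p <- s) p.2 ⊗ lconv p.1 f h).
  rewrite big_seq; elim/big_ind: _ => [|u v|p /sCs[_ Cp]]; first exact: subspace_CC.1.
    exact: (subspaceD subspace_CC).
  by apply: CC_tn => //; apply: C_lconv.
apply: legr_cancelr => // b; rewrite mR_legr [T2 _]linear_sum mR_sum.
under eq_bigr => p _.
  rewrite -mL_legl_T1; have := lconv_T1 p.1 f (h ⊗ b); rewrite tmapE => ->; over.
have -> : lconv a f h ⊗ (h ** b) =
    tmap (lconv a f \o mL (embed h)) idA (T1 (h ⊗ b)).
  rewrite -[RHS](tmap_comp (mL (embed h)) idA (lconv a f) idA).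
  rewrite -[tmap (mL (embed h)) idA _]/(mL (legl h) _).
  by rewrite mL_legl_T1 T2_hh mR_legr tmapE.
elim/tens_ind: (T1 _) => [|x y|u v Hu Hv].
- by rewrite linear0 big1 // => p _; rewrite !linear0.
- rewrite tmapE -[X in X ⊗ _ = _]/(lconv a f (h ** x)) (lconv_mul _ _ sE) tn_suml.
  by apply: eq_bigr => p _; rewrite tmapE mL_legl.
- rewrite tmapD Hu Hv -big_split; apply: eq_bigr => p _.
  by rewrite tmapD mLD.
Qed.

Lemma CC_tmap (u v : {linear A -> A}) t : (forall c, C c -> C (u c)) ->
  (forall c, C c -> C (v c)) -> CC t -> CC (tmap u v t).
Proof.
move=> Cu Cv; move: t; apply: CC_ind => [|c d Cc Cd]; last first.
  by rewrite tmapE; apply: CC_tn; [apply: Cu|apply: Cv].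
have [CC0 CCl] := subspace_CC.
by split=> [|k s t Hs Ht]; rewrite ?linear0 // linearP; apply: CCl.
Qed.

Lemma subspace_image (T : {linear tens A A -> tens A A}) (V : lmodType K)
    (f : {linear V -> tens A A}) :
  subspace [set x | exists2 s, CC s & f x = T s].
Proof.
have [CC0 CCl] := subspace_CC.
split=> [|k x y [s Cs xE] [t Ct yE]]; first by exists 0; rewrite ?linear0.
by exists (k *: s + t); [apply: CCl|rewrite !linearP /= xE yE].
Qed.

(** Once h ⊗ d has a preimage, [lconv] in the first leg replaces h by an arbitrary c, as it commutes
    with T1 and preserves C. *)
Lemma T1_preimage t : CC t -> exists2 s, CC s & t = T1 s.
Proof.
move: t; apply: CC_ind => [|c d Cc Cd]; first exact: (subspace_image T1 idfun).
have [s Cs sE] : exists2 s, CC s & h ⊗ d = T1 s.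
  move: d Cd; apply: (C_left_min (subspace_image T1 (tn h))) => g b.
  exact: T1_preimage_h.
move: c Cc; apply: (C_lconv_min (subspace_image T1 (tnr d))) => a f.
exists (tmap (lconv a f) idA s); first by apply: CC_tmap => // c; apply: lconv_C.
by rewrite lconv_T1 -sE tmapE.
Qed.

Lemma T2_preimage t : CC t -> exists2 s, CC s & t = T2 s.
Proof.
move: t; apply: CC_ind => [|c d Cc Cd]; first exact: (subspace_image T2 idfun).
have [s Cs sE] : exists2 s, CC s & c ⊗ h = T2 s.
  move: c Cc; apply: (C_lconv_min (subspace_image T2 (tnr h))) => a f.
  exact: T2_preimage_h.
move: d Cd; apply: (C_left_min (subspace_image T2 (tn c))) => g b.
exists (tmap idA (rconv b g) s); first by apply: CC_tmap => // d; apply: rconv_C.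
by rewrite rconv_T2 -sE tmapE.
Qed.

(* (d ⊗ c)Δ(h) = Σ (d_j ⊗ 1)Δ(c_j h) when d ⊗ c = Σ (d_j ⊗ 1)Δ(c_j), and
   Δ(c_j h) = ε(c_j)Δ(h). *)
Lemma C_mul c d : C c -> C d -> C (c ** d).
Proof.
move=> Cc; have sW : subspace (fun d => C (c ** d)).
  split=> [|k x y Cx Cy]; first by rewrite amul0r; case: sC.
  by rewrite amulDr amulZr; apply: sC.2.
move: d; apply: (C_right_min sW) => f b; rewrite -lslice_mL_legr.
move: f; apply: (in_right_cancel_mL sC C_cancel) => d Cd.
have -> : mL (legl d) (mL (legr c) (T3 h b)) = (d ⊗ c) ** T3 h b.
  by apply: einj; rewrite !embed_mL embedM mulrA legl_legr.
have sr := subspace_in_right A sC.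
have [s Cs ->] := T2_preimage (CC_tn Cd Cc); move: s Cs; apply: CC_ind.
  split=> [|k s t Hs Ht]; first by rewrite linear0 amul0l; apply: sr.1.
  by rewrite linearP amulDl amulZl; apply: sr.2.
move=> x y Cx Cy.
have -> : T2 (x ⊗ y) ** T3 h b = eps y *: mL (legl x) (T3 h b).
  transitivity (mL (legl x) (T3 (y ** h) b)).
    by apply: einj; rewrite embedM embed_mL T2E !T3E DeltaM !mulrA.
  by rewrite C_mul_h // T3Z; apply: linearZ.
apply: (subspaceZ _ sr) => f; rewrite lslice_mL_legl.
exact: C_right.
Qed.

(** The right leg is visible after covering the first one: slices of (a ⊗ 1)Δ(c)(1 ⊗ d) are products
    ω(a c_(1)) c_(2) d of elements of C. *)
Lemma CC_T1 t : CC t -> CC (T1 t).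
Proof.
move: t; apply: CC_ind => [|c d Cc Cd].
  have [CC0 CCl] := subspace_CC.
  by split=> [|k s t Hs Ht]; rewrite ?linear0 // linearP; apply: CCl.
split=> [g|]; first exact: rconv_C.
apply: (in_right_cancel_mL sC nd_setT) => a _ f.
rewrite mL_legl_T1 lslice_mR_legr; apply: C_mul => //; exact: lconv_C.
Qed.

Lemma CC_T2 t : CC t -> CC (T2 t).
Proof.
move: t; apply: CC_ind => [|c d Cc Cd].
  have [CC0 CCl] := subspace_CC.
  by split=> [|k s t Hs Ht]; rewrite ?linear0 // linearP; apply: CCl.
split=> [|g]; last exact: lconv_C.
apply: in_left_cancel_mR => // b g.
rewrite -mL_legl_T1 rslice_mL_legl; apply: C_mul => //; exact: rconv_C.
Qed.

Lemma CC_T1i t : CC t -> CC (T1i t).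
Proof. by move=> /T1_preimage[s Cs ->]; rewrite T1K. Qed.

Lemma CC_T2i t : CC t -> CC (T2i t).
Proof. by move=> /T2_preimage[s Cs ->]; rewrite T2K. Qed.

Lemma CC_star t : CC t -> CC (star t).
Proof.
have [CC0 CCl] := subspace_CC.
move: t; apply: CC_ind => [|c d Cc Cd].
  split=> [|k x y Hx Hy]; first by rewrite star0.
  by rewrite star_antilinear; apply: CCl.
by rewrite tens_star; apply: CC_tn; apply: C_star.
Qed.

Lemma CC_mL_Delta c t : C c -> CC t -> CC (mL (Delta c) t).
Proof.
have [CC0 CCl] := subspace_CC.
move=> Cc; move: t; apply: CC_ind => [|x y Cx Cy].
  by split=> [|k s t Hs Ht]; rewrite ?linear0 // linearP; apply: CCl.
rewrite -mR_legl_T1; apply: CC_tmap => [z Cz|z Cz|]; first exact: C_mul.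
  by [].
by apply: CC_T1; apply: CC_tn.
Qed.

Lemma CC_mR_Delta c t : C c -> CC t -> CC (mR (Delta c) t).
Proof.
move=> Cc Ct; rewrite -[mR _ _]starK -[t]starK -mL_mstar -Delta_star.
by apply/CC_star/CC_mL_Delta; [apply: C_star|apply: CC_star].
Qed.

Lemma C_h : C h.
Proof. by rewrite -[h]scale1r -w0h -rslice_tn -T1_hh; apply: C_left. Qed.

(** * Positivity of the integral and its value at h *)

Section Integral.
Variable phi : {scalar A}.
Hypothesis phi_pos : forall a, 0 <= phi (star a ** a).
Hypothesis phi_inv : forall a, is_mult_slice phi (Delta a) (phi a *: (1 : mult A)).

Lemma phi_T3 a b : rslice phi (T3 a b) = phi a *: b.
Proof.
have [[t [tE tb]] _] := phi_inv a b; rewrite -[RHS]tb.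
by congr (rslice phi _); apply: einj; rewrite tE T3E.
Qed.

Lemma phi_T2 a b : rslice phi (T2 (b ⊗ a)) = phi a *: b.
Proof.
have [_ [t [tE tb]]] := phi_inv a b; rewrite -[RHS]tb.
by congr (rslice phi _); apply: einj; rewrite tE T2E.
Qed.

Lemma positive_affine_slope (p q : K) :
  (forall k : K, k \is Num.real -> 0 <= k * p + q) -> p = 0.
Proof.
move=> pos; have q0 : 0 <= q by have := pos 0 (real0 _); rewrite mul0r add0r.
have pR : p \is Num.real.
  have -> : p = (1 * p + q) - q by rewrite mul1r addrK.
  by apply: realB; apply: ger0_real => //; apply: pos; apply: real1.
apply/eqP/negPn/negP => p0.
(* At this k the affine function takes the value -1. *)
have kR : - (q + 1) / p \is Num.real.
  apply: realM; last by rewrite realV.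
  by rewrite realN; apply: realD; [apply: ger0_real|apply: real1].
have := pos _ kR; rewrite divfK // opprD -addrA [- 1 + _]addrC addKr.
by rewrite oppr_ge0 ler10.
Qed.

(** A Cauchy-Schwarz argument: φ of star(lx + y)(lx + y) has no quadratic term in l, so it is affine
    along real and along imaginary l. Both slopes vanish, giving u + v = 0 and v - u = 0. *)
Lemma phi_null_left x : phi (star x ** x) = 0 -> forall y, phi (star x ** y) = 0.
Proof.
move=> x0 y; set u := phi _; pose v := phi (star y ** x); pose w := phi (star y ** y).
have pos (l : K) : 0 <= l^* * u + l * v + w.
  have := phi_pos (l *: x + y).
  rewrite star_antilinear amulDl !amulDr !amulZl !amulZr !linearD !linearZ /=.
  by rewrite x0 !mulr0 add0r addrA.
have uv : u + v = 0.
  apply: (@positive_affine_slope _ w) => t tR; have := pos t.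
  by rewrite (CrealP tR) -mulrDr.
have vu : 'i * (v - u) = 0.
  apply: (@positive_affine_slope _ w) => t tR; have := pos (t * 'i).
  rewrite rmorphM /= conjCi (CrealP tR) mulrN mulNr.
  by rewrite [- _ + _]addrC -mulrBr mulrA.
have: u *+ 2 == 0.
  have /eqP := vu; rewrite mulf_eq0 (negbTE (neq0Ci _)) subr_eq0 => /eqP vE.
  by rewrite mulr2n -{2}vE uv.
by rewrite mulrn_eq0 /= => /eqP.
Qed.

Lemma phi_h_neq0 : (exists a, phi a != 0) -> phi h != 0.
Proof.
move=> [a0 pa0]; apply/negP => /eqP ph0; case/eqP: pa0.
have ph y : phi (h ** y) = 0.
  by rewrite -{1}hstar phi_null_left // hstar hh.
(* The elements Δ(a)(b ⊗ 1) span A ⊗ A, and invariance gives φ(ha) b = 0 on them. *)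
have Dh s : rslice phi (mL (Delta h) s) = 0.
  have [r ->] := T3_surjective s; rewrite mL_sum linear_sum big1 // => p _ /=.
  by rewrite mL_Delta_T3 phi_T3 ph scale0r.
apply: (C_mul_spans (W := fun a => phi a = 0)) => [|c z].
  split=> [|k x y x0 y0]; first by rewrite linear0.
  by rewrite linearP x0 y0 /= mulr0 addr0.
apply: (C_right_min (W := fun c => phi (c ** z) = 0)) => [|f x].
  split=> [|k u v u0 v0]; first by rewrite amul0l linear0.
  by rewrite amulDl amulZl linearP u0 v0 /= mulr0 addr0.
by rewrite -lslice_mR_legr slice_exchange mR_legr_T3 mR_legl_T1 Dh linear0.
Qed.

(** * The restriction of the coproduct to the leg *)

Section Subalgebra.
Variable B : submodClosed A.
Hypothesis BP : forall x, reflect (C x) (x \in B).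
Hypothesis phi_neq0 : exists a, phi a != 0.

Lemma B_star_closed : star_closed B.
Proof.
split=> [a b /BP Ca /BP Cb|a /BP Ca]; apply/BP; first exact: C_mul.
exact: C_star.
Qed.

Local Notation D := (subalg B_star_closed).
Local Notation DD := (tens D D).

Lemma val_linear : linear (val : D -> A).
Proof. by []. Qed.
Local Notation inc := (to_linear val_linear).

Lemma incP (x : D) : C (inc x).
Proof. exact/BP/subalg_valP. Qed.

Lemma inc_inj : injective inc.
Proof. exact: val_inj. Qed.

Lemma incM (x y : D) : inc (x ** y) = inc x ** inc y.
Proof. by []. Qed.

Lemma inc_star (x : D) : inc (star x) = star (inc x).
Proof. by []. Qed.

(** A merely linear projection onto C. It makes D ⊗ D embed into A ⊗ A and brings operators that
    preserve C ⊗ C back to D ⊗ D. *)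
Lemma retraction_exists : exists pr : {linear A -> D},
  (forall x : D, pr (inc x) = x) /\ (forall c : A, C c -> inc (pr c) = c).
Proof.
have [pi [piC pi_id]] := projection_exists sC.
have piB x : pi x \in B by apply/BP/piC.
have lpr : linear (fun x => Subalg B_star_closed (piB x)).
  by move=> k x y; apply: val_inj; rewrite /= linearP.
exists (to_linear lpr); split=> [x|c Cc]; first apply: val_inj.
  by apply: pi_id; apply: incP.
exact: pi_id.
Qed.

Section Retraction.
Variable pr : {linear A -> D}.
Hypothesis incK : forall x : D, pr (inc x) = x.
Hypothesis prK : forall c : A, C c -> inc (pr c) = c.

Local Notation incl := (tmap inc inc).
Local Notation ret := (tmap pr pr).

Lemma inclK (t : DD) : ret (incl t) = t.
Proof. by rewrite tmap_comp -[RHS]tmap_id; apply: eq_tmap => x; apply: incK. Qed.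

Lemma incl_inj : injective (incl : DD -> tens A A).
Proof. exact: can_inj inclK. Qed.

Lemma incl_CC (t : DD) : CC (incl t).
Proof.
elim/tens_ind: t => [|x y|s t Hs Ht].
- by rewrite linear0; apply: subspace_CC.1.
- by rewrite tmapE; apply: CC_tn; apply: incP.
- by rewrite tmapD; apply: (subspaceD subspace_CC).
Qed.

Lemma retK (t : tens A A) : CC t -> incl (ret t) = t.
Proof.
move: t; apply: CC_ind => [|c d Cc Cd]; last by rewrite !tmapE !prK.
by split=> [|k s t Hs Ht]; rewrite ?linear0 // !linearP /= Hs Ht.
Qed.

Lemma inclM (s t : DD) : incl (s ** t) = incl s ** incl t.
Proof.
elim/tens_ind: s => [|x y|s s' Hs Hs']; first by rewrite amul0l linear0 amul0l.
  elim/tens_ind: t => [|x' y'|t t' Ht Ht']; first by rewrite amul0r linear0 amul0r.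
    by rewrite tens_mul !tmapE tens_mul.
  by rewrite amulDr !tmapD amulDr Ht Ht'.
by rewrite amulDl !tmapD amulDl Hs Hs'.
Qed.

Lemma incl_star (t : DD) : incl (star t) = star (incl t).
Proof.
elim/tens_ind: t => [|x y|s t Hs Ht]; first by rewrite linear0 !star0 linear0.
  by rewrite tens_star !tmapE tens_star.
by rewrite starD !tmapD starD Hs Ht.
Qed.

Definition mult_restricts (x : mult DD) (y : mult (tens A A)) : Prop :=
  forall t : DD, incl (mL x t) = mL y (incl t) /\ incl (mR x t) = mR y (incl t).

(** A multiplier of A ⊗ A determines the multiplier of D ⊗ D that it induces, so identities
    satisfied by Δ pass to C. *)
Lemma mult_restricts_inj (x x' : mult DD) (y y' : mult (tens A A)) :
  mult_restricts x y -> mult_restricts x' y' -> y = y' -> x = x'.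
Proof.
move=> xy xy' yy'; rewrite -{}yy' in xy'.
apply: multP => t; apply: incl_inj; first by rewrite (xy t).1 (xy' t).1.
by rewrite (xy t).2 (xy' t).2.
Qed.

Lemma mult_restrictsM (x x' : mult DD) (y y' : mult (tens A A)) :
  mult_restricts x y -> mult_restricts x' y' ->
  mult_restricts (x * x') (y * y').
Proof.
move=> xy xy' t; split.
  by rewrite -[mL _ _]/(mL x (mL x' t)) (xy _).1 (xy' _).1.
by rewrite -[mR _ _]/(mR x' (mR x t)) (xy' _).2 (xy _).2.
Qed.

Lemma mult_restricts_star (x : mult DD) (y : mult (tens A A)) :
  mult_restricts x y -> mult_restricts (mstar x) (mstar y).
Proof.
move=> xy t; rewrite !mL_mstar !mR_mstar -incl_star -(xy _).1 -(xy _).2.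
by rewrite !incl_star.
Qed.

Lemma mult_restricts_embed (t : DD) : mult_restricts (embed t) (embed (incl t)).
Proof. by move=> s; rewrite !mL_embed !mR_embed !inclM. Qed.

Lemma mult_restricts_legl (x : D) : mult_restricts (legl x) (legl (inc x)).
Proof.
move=> t; split; elim/tens_ind: t => [|y z|s t Hs Ht].
- by rewrite !linear0.
- by rewrite mL_legl !tmapE mL_legl.
- by rewrite mLD !tmapD mLD Hs Ht.
- by rewrite !linear0.
- by rewrite mR_legl !tmapE mR_legl.
- by rewrite mRD !tmapD mRD Hs Ht.
Qed.

Lemma mult_restricts_legr (x : D) : mult_restricts (legr x) (legr (inc x)).
Proof.
move=> t; split; elim/tens_ind: t => [|y z|s t Hs Ht].
- by rewrite !linear0.
- by rewrite mL_legr !tmapE mL_legr.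
- by rewrite mLD !tmapD mLD Hs Ht.
- by rewrite !linear0.
- by rewrite mR_legr !tmapE mR_legr.
- by rewrite mRD !tmapD mRD Hs Ht.
Qed.

Lemma incl_ret_mL (c : D) (t : DD) :
  incl (ret (mL (Delta (inc c)) (incl t))) = mL (Delta (inc c)) (incl t).
Proof. by apply/retK/CC_mL_Delta; [apply: incP|apply: incl_CC]. Qed.

Lemma incl_ret_mR (c : D) (t : DD) :
  incl (ret (mR (Delta (inc c)) (incl t))) = mR (Delta (inc c)) (incl t).
Proof. by apply/retK/CC_mR_Delta; [apply: incP|apply: incl_CC]. Qed.

Definition Delta_restr (c : D) : mult DD.
Proof.
refine (@Mult _ _ (fun t : DD => ret (mL (Delta (inc c)) (incl t)))
  (fun t : DD => ret (mR (Delta (inc c)) (incl t))) _ _ _ _ _).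
- by move=> k s t; rewrite !linearP.
- by move=> k s t; rewrite !linearP.
- by move=> s t; apply: incl_inj; rewrite incl_ret_mL !inclM incl_ret_mL mL_mul.
- by move=> s t; apply: incl_inj; rewrite incl_ret_mR !inclM incl_ret_mR mR_mul.
- move=> s t; apply: incl_inj.
  by rewrite !inclM incl_ret_mL incl_ret_mR mLR.
Defined.

Lemma Delta_restrP (c : D) : mult_restricts (Delta_restr c) (Delta (inc c)).
Proof. by move=> t; split; [apply: incl_ret_mL|apply: incl_ret_mR]. Qed.

Lemma Delta_restr_linear : linear Delta_restr.
Proof.
move=> k a b; apply: multP => t; apply: incl_inj.
  rewrite (Delta_restrP _ t).1 !linearP mL_lincomb.
  by rewrite -(Delta_restrP a t).1 -(Delta_restrP b t).1.
rewrite (Delta_restrP _ t).2 !linearP mR_lincomb.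
by rewrite -(Delta_restrP a t).2 -(Delta_restrP b t).2.
Qed.

Definition DeltaC : {linear D -> mult DD} := to_linear Delta_restr_linear.

Lemma DeltaCP (c : D) : mult_restricts (DeltaC c) (Delta (inc c)).
Proof. exact: Delta_restrP. Qed.

Section RestrictedMap.
Variable T : {linear tens A A -> tens A A}.
Hypothesis CC_T : forall t, CC t -> CC (T t).
Definition restrict_map : {linear DD -> DD} := ret \o T \o incl.

Lemma incl_restrict_map (t : DD) : incl (restrict_map t) = T (incl t).
Proof. by apply/retK/CC_T/incl_CC. Qed.
End RestrictedMap.

Definition T1C := restrict_map T1.
Definition T2C := restrict_map T2.

Lemma incl_T1C (t : DD) : incl (T1C t) = T1 (incl t).
Proof. exact: (incl_restrict_map CC_T1). Qed.
Lemma incl_T2C (t : DD) : incl (T2C t) = T2 (incl t).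
Proof. exact: (incl_restrict_map CC_T2). Qed.

Lemma T1C_E (a b : D) : embed (T1C (a ⊗ b)) = DeltaC a * legr b.
Proof.
apply: (mult_restricts_inj (mult_restricts_embed _)
  (mult_restrictsM (DeltaCP a) (mult_restricts_legr b))).
by rewrite incl_T1C tmapE T1E.
Qed.

Lemma T2C_E (a b : D) : embed (T2C (a ⊗ b)) = legl a * DeltaC b.
Proof.
apply: (mult_restricts_inj (mult_restricts_embed _)
  (mult_restrictsM (mult_restricts_legl a) (DeltaCP b))).
by rewrite incl_T2C tmapE T2E.
Qed.

Lemma T1C_bij : bijective T1C.
Proof.
exists (restrict_map T1i) => t; apply: incl_inj.
  by rewrite (incl_restrict_map CC_T1i) incl_T1C T1K.
by rewrite incl_T1C (incl_restrict_map CC_T1i) T1iK.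
Qed.

Lemma T2C_bij : bijective T2C.
Proof.
exists (restrict_map T2i) => t; apply: incl_inj.
  by rewrite (incl_restrict_map CC_T2i) incl_T2C T2K.
by rewrite incl_T2C (incl_restrict_map CC_T2i) T2iK.
Qed.

Lemma D_nondegenerate : nondegenerate D.
Proof.
split=> [a a0|b b0]; apply: inc_inj; rewrite linear0.
  apply: nd.1; apply: C_mul_spans => [|c x Cc].
    split=> [|k x y x0 y0]; first by rewrite amul0r.
    by rewrite amulDr amulZr x0 y0 scaler0 addr0.
  by rewrite amulA -(prK Cc) -incM a0 linear0 amul0l.
by apply: C_cancel => c Cc; rewrite -(prK Cc) -incM b0 linear0.
Qed.

Lemma DeltaC_star_hom : star_hom DeltaC.
Proof.
split=> [a b|a].
  apply: (mult_restricts_inj (DeltaCP _) (mult_restrictsM (DeltaCP a) (DeltaCP b))).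
  by rewrite incM DeltaM.
apply: (mult_restricts_inj (DeltaCP _) (mult_restricts_star (DeltaCP a))).
by rewrite inc_star Delta_star.
Qed.

(** In the Galois form both sides are elements, which can be compared after the injection into A ⊗
    (A ⊗ A). *)
Lemma DeltaC_coassociative : coassociative DeltaC.
Proof.
apply/(coassociativeP D_nondegenerate T1C_E T2C_E) => a b c.
have /(coassociativeP nd T1E T2E) := coas => /(_ (inc a) (inc b) (inc c)) co.
have incl3K (t : tens D DD) : tmap pr ret (tmap inc incl t) = t.
  by rewrite tmap_comp -[RHS]tmap_id; apply: eq_tmap => x; [apply: incK|apply: inclK].
apply: (can_inj incl3K).
have -> (t : tens DD D) : tmap inc incl (tassoc t) = tassoc (tmap incl inc t).
  elim/tens_ind: t => [|s x|s t Hs Ht]; first by rewrite !linear0.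
    elim/tens_ind: s => [|y z|s t Hs Ht]; first by rewrite tn0l !linear0.
      by rewrite tassoc_tn !tmapE [in LHS]/= [in RHS]/= !tmapE tassoc_tn.
    by rewrite tnDl !(linearD, tmapD) /= Hs Ht.
  by rewrite !(linearD, tmapD) /= Hs Ht.
have tn_inc (x y : D) : inc x ⊗ inc y = incl (x ⊗ y) by rewrite tmapE.
have -> : tmap incl inc
      (tmap (T2C \o tn a) (idfun : {linear D -> D}) (T1C (b ⊗ c))) =
    tmap (T2 \o tn (inc a)) idA (T1 (inc b ⊗ inc c)).
  rewrite tn_inc -incl_T1C; move: (T1C (_ ⊗ _)) => s; rewrite !tmap_comp.
  apply: eq_tmap => // x.
  by rewrite -[LHS]/(incl (T2C (a ⊗ x))) incl_T2C tmapE.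
have -> : tmap inc incl
      (tmap (idfun : {linear D -> D}) (T1C \o tnr c) (T2C (a ⊗ b))) =
    tmap idA (T1 \o tnr (inc c)) (T2 (inc a ⊗ inc b)).
  rewrite tn_inc -incl_T2C; move: (T2C _) => s; rewrite !tmap_comp.
  apply: eq_tmap => // x.
  by rewrite -[LHS]/(incl (T1C (x ⊗ c))) incl_T1C tmapE.
exact: co.
Qed.

Definition hC : D := pr h.
Lemma inc_hC : inc hC = h.
Proof. exact/prK/C_h. Qed.

Lemma DeltaC_nondegenerate_hom : nondegenerate_hom DeltaC.
Proof.
have ndtD := tens_nondegenerate D_nondegenerate D_nondegenerate.
pose P (t : DD) := exists u : seq (D * DD), t = \sum_(p <- u) mL (DeltaC p.1) p.2.
have P0 : P 0 by exists [::]; rewrite big_nil.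
have PD (s t : DD) : P s -> P t -> P (s + t).
  by move=> [u ->] [v ->]; exists (u ++ v); rewrite big_cat.
have PT1 (s : DD) (x : D) : P (mR (legl x) (T1C s)).
  elim/tens_ind: s => [|a b|s t Hs Ht]; first by rewrite !linear0.
    exists [:: (a, x ⊗ b)]; rewrite big_seq1; apply: (embed_inj ndtD).
    by rewrite embed_mR embed_mL T1C_E -mulrA legr_legl.
  by rewrite linearD mRD; apply: PD.
have Pt (t : DD) : P t.
  elim/tens_ind: t => // x y.
  (* D is spanned by products: x = ε(h) x is m(T1i(h ⊗ x)), and [T1i] preserves C ⊗ C. *)
  have [r xE] : exists r : seq (D * D), x = \sum_(p <- r) p.1 ** p.2.
    exists (trepr (restrict_map T1i (hC ⊗ x))); apply: inc_inj.
    rewrite -[LHS]scale1r -counit_h -mulm_T1i -inc_hC.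
    rewrite -[inc hC ⊗ inc x]tmapE -(incl_restrict_map CC_T1i).
    rewrite {1}(tensE (restrict_map _ _)) tmap_sum [mulm _]linear_sum [RHS]linear_sum.
    by apply: eq_bigr => p _; rewrite tmapE; apply: mulmE.
  rewrite {}xE tn_suml; elim/big_ind: _ => // p _.
  have [T1iC _ T1CK] := T1C_bij.
  (* (p.1 p.2) ⊗ y is (p.1 ⊗ y)(p.2 ⊗ 1), with p.1 ⊗ y in the range of [T1C]. *)
  by rewrite -mR_legl -[p.1 ⊗ y]T1CK.
move=> t; split; first exact: Pt.
have [u tE] := Pt (star t); exists [seq (star p.1, star p.2) | p <- u].
rewrite big_map -[LHS]starK tE star_sum; apply: eq_bigr => p _.
rewrite -[RHS]/(mR (DeltaC (star p.1)) (star p.2)) DeltaC_star_hom.2.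
by rewrite mR_mstar starK.
Qed.

Lemma DeltaC_multiplier_hopf : multiplier_hopf_star DeltaC.
Proof.
split; [exact: D_nondegenerate|exact: DeltaC_star_hom|
  exact: DeltaC_nondegenerate_hom|exact: DeltaC_coassociative|split].
  by exists T1C; split; [exact: T1C_bij|exact: T1C_E].
by exists T2C; split; [exact: T2C_bij|exact: T2C_E].
Qed.

Definition phiC : {scalar D} := phi \o inc.
Definition epsC : {scalar D} := eps \o inc.

Lemma CC_T3 a b : C a -> C b -> CC (T3 a b).
Proof. by move=> Ca Cb; apply/CC_star/CC_T2/CC_tn; apply: C_star. Qed.

Lemma phiC_left_integral : positive_left_integral DeltaC phiC.
Proof.
split.
- by exists hC; rewrite -[phiC _]/(phi (inc hC)) inc_hC phi_h_neq0.
- by move=> a; apply: (phi_pos (inc a)).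
move=> a b; split.
  exists (ret (T3 (inc a) (inc b))); have TC := CC_T3 (incP a) (incP b); split.
    apply: (mult_restricts_inj (mult_restricts_embed _)
      (mult_restrictsM (DeltaCP a) (mult_restricts_legl b))).
    by rewrite retK // T3E.
  apply: inc_inj; rewrite -[id_slice _ _]/(rslice (phi \o inc) _).
  rewrite -rslice_tmap retK //.
  by rewrite phi_T3 -[mL _ b]/(phiC a *: b) linearZ.
exists (T2C (b ⊗ a)); split; first exact: T2C_E.
apply: inc_inj; rewrite -[id_slice _ _]/(rslice (phi \o inc) _) -rslice_tmap.
by rewrite incl_T2C tmapE phi_T2 -[mR _ b]/(phiC a *: b) linearZ.
Qed.

Lemma epsC_counit : is_counit DeltaC epsC.
Proof.
have ndtD := tens_nondegenerate D_nondegenerate D_nondegenerate.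
split=> [a b|a b t tE|a b t tE]; first exact: counitM.
  have -> : t = T1C (a ⊗ b) by apply: (embed_inj ndtD); rewrite T1C_E.
  apply: inc_inj; rewrite -[slice_id _ _]/(lslice (eps \o inc) _) -lslice_tmap.
  by rewrite incl_T1C tmapE counit_T1 mulmE.
have -> : t = T2C (a ⊗ b) by apply: (embed_inj ndtD); rewrite T2C_E.
apply: inc_inj; rewrite -[id_slice _ _]/(rslice (eps \o inc) _) -rslice_tmap.
by rewrite incl_T2C tmapE counit_T2 mulmE.
Qed.

Lemma hC_neq0 : hC != 0.
Proof. by apply/eqP => h0; move: h_neq0; rewrite -inc_hC h0 linear0 eqxx. Qed.

Lemma hC_left_cointegral : left_cointegral DeltaC hC.
Proof.
split; first exact: hC_neq0.
exists epsC => [|a]; first exact: epsC_counit.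
apply: inc_inj; rewrite incM linearZ /= inc_hC; exact: C_mul_h (incP a).
Qed.

Lemma hC_right_cointegral : right_cointegral DeltaC hC.
Proof.
split; first exact: hC_neq0.
exists epsC => [|a]; first exact: epsC_counit.
apply: inc_inj; rewrite incM linearZ /= inc_hC; exact: h_mul_C (incP a).
Qed.

End Retraction.

Lemma subalgebra_discrete :
  exists (clB : star_closed B)
    (DeltaB : {linear subalg clB -> mult (tens (subalg clB) (subalg clB))}),
    [/\ restricts Delta DeltaB,
        discrete_quantum_group DeltaB
      & exists hB : subalg clB,
          [/\ val hB = h, left_cointegral DeltaB hB
            & right_cointegral DeltaB hB]].
Proof.
have [pr [incK prK]] := retraction_exists.
exists B_star_closed, (DeltaC incK prK); split.
- exact: DeltaCP.
- split; last by exists (hC pr); apply: hC_left_cointegral.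
  split; first exact: DeltaC_multiplier_hopf.
  by exists phiC; apply: phiC_left_integral.
- exists (hC pr); split; first exact: inc_hC.
    exact: hC_left_cointegral.
  exact: hC_right_cointegral.
Qed.

End Subalgebra.
End Integral.
End GroupLike.
End Counit.
End MultiplierHopfStar.

(** * From set-theoretic subspaces to boolean predicates, and conclusion *)

Section SubspacePredicate.
Variables (K : fieldType) (V : lmodType K) (W : set V).
Hypothesis sW : subspace W.

(** Keeping the proof of [subspace W] in the term lets the closure instance be found from the
    predicate alone. *)
Definition subspace_pred & subspace W : {pred V} := fun x => `[< W x >].

Lemma subspace_predP x : reflect (W x) (x \in subspace_pred sW).
Proof. exact: asboolP. Qed.

Lemma subspace_pred_closed : submod_closed (subspace_pred sW).
Proof.
split; first by apply/subspace_predP; case: sW.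
by move=> k x y /subspace_predP Wx /subspace_predP Wy; apply/subspace_predP/sW.2.
Qed.

HB.instance Definition _ :=
  GRing.isSubmodClosed.Build K V (subspace_pred sW) subspace_pred_closed.

Definition to_submodClosed : submodClosed V := subspace_pred sW.

End SubspacePredicate.

Section InTensor.
Variables (K : fieldType) (A B : lmodType K).

Lemma lslice_in_tens (W : submodClosed B) f (t : tens A B) :
  in_tens predT W t -> lslice f t \in W.
Proof.
case=> s [/allP sW ->]; rewrite linear_sum big_seq rpred_sum // => p /sW /= pW.
by rewrite lslice_tn rpredZ.
Qed.

Lemma rslice_in_tens (U : submodClosed A) g (t : tens A B) :
  in_tens U predT t -> rslice g t \in U.
Proof.
case=> s [/allP sU ->]; rewrite linear_sum big_seq rpred_sum // => p /sU /= pU.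
by rewrite rslice_tn rpredZ //; case/andP: pU.
Qed.

Lemma in_tens_right (W : set B) (sW : subspace W) (t : tens A B) :
  in_right W t -> in_tens predT (to_submodClosed sW) t.
Proof.
move=> Wt; have [s -> sWs] := in_legs_sum (subspace_setT A) sW (fun=> I) Wt.
exists s; split=> //; apply/allP => p /sWs[_ Wp].
by apply/andP; split=> //; apply/subspace_predP.
Qed.

Lemma in_tens_left (U : set A) (sU : subspace U) (t : tens A B) :
  in_left U t -> in_tens (to_submodClosed sU) predT t.
Proof.
move=> Ut; have [s -> sUs] := in_left_sum sU Ut.
exists s; split=> //; apply/allP => p /sUs Up.
by apply/andP; split=> //; apply/subspace_predP.
Qed.

End InTensor.

Lemma bijective_linear_inverse (K : pzRingType) (V : lmodType K)
    (T : {linear V -> V}) : bijective T ->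
  exists Ti : {linear V -> V}, cancel T Ti /\ cancel Ti T.
Proof.
case=> g TK gK; have lg : linear g := can2_linear TK gK.
by exists (to_linear lg).
Qed.

Lemma leg_discrete_quantum_group (K : numClosedFieldType) (A : starAlgType K)
  (Delta : {linear A -> mult (tens A A)}) (h : A) (C : submodClosed A) :
  algebraic_quantum_group Delta ->
  group_like_projection Delta h ->
  is_right_leg Delta h C ->
  is_left_leg Delta h C ->
  exists (clC : star_closed C)
    (DeltaC : {linear subalg clC -> mult (tens (subalg clC) (subalg clC))}),
    [/\ restricts Delta DeltaC,
        discrete_quantum_group DeltaC
      & exists hC : subalg clC,
          [/\ val hC = h, left_cointegral DeltaC hC
            & right_cointegral DeltaC hC]].
Proof.
move=> [[nd [DM Dstar] _ co [[T1 [bT1 T1E]] [T2 [bT2 T2E]]]] [phi]].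
move=> [phi0 phip phii].
move=> [h0 hh hs hgl] [Cr Crmin] [Cl Clmin].
have [T1i [T1K T1iK]] := bijective_linear_inverse bT1.
have [T2i [T2K T2iK]] := bijective_linear_inverse bT2.
have einj := embed_inj (tens_nondegenerate nd nd).
have [w w_h] := functional_exists h0.
pose W : set A := fun x => x \in C.
have sW : subspace W.
  split=> [|k x y Cx Cy]; first exact: rpred0.
  by apply: rpredD => //; apply: rpredZ.
have T3h := T3E Dstar T2E h.
apply: (subalgebra_discrete nd DM Dstar T1E T2E T1K T1iK T2K T2iK co w_h hh hs hgl
  sW _ _ _ _ phip phii (fun=> idP) phi0).
- move=> f b; have [t tE] := Cr b.
  have -> : t = T3 T2 h b by apply: einj; rewrite T3h.
  exact: lslice_in_tens.
(* Minimality of the leg speaks of boolean predicates; excluded middle turns any subspace U into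
   one. *)
- move=> U sU Ul x Cx; apply/(subspace_predP sU).
  move: x Cx; apply: (Crmin (to_submodClosed sU)) => b.
  by exists (T3 T2 h b) => //; apply: in_tens_right => f; apply: Ul.
- move=> g b; have [t tE] := Cl b.
  have -> : t = T1 (h ⊗ b) by apply: einj; rewrite T1E.
  exact: rslice_in_tens.
- move=> U sU Ul x Cx; apply/(subspace_predP sU).
  move: x Cx; apply: (Clmin (to_submodClosed sU)) => b.
  by exists (T1 (h ⊗ b)) => //; apply: in_tens_left => g; apply: Ul.
Qed.

Theorem theorem3p8 (R : realType) (A : starAlgType R[i])
  (Delta : {linear A -> mult (tens A A)}) (h : A) (C : submodClosed A) :
  algebraic_quantum_group Delta ->
  group_like_projection Delta h ->
  is_right_leg Delta h C ->
  is_left_leg Delta h C ->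
  exists (clC : star_closed C)
    (DeltaC : {linear subalg clC -> mult (tens (subalg clC) (subalg clC))}),
    [/\ restricts Delta DeltaC,
        discrete_quantum_group DeltaC
      & exists hC : subalg clC,
          [/\ val hC = h, left_cointegral DeltaC hC
            & right_cointegral DeltaC hC]].
Proof. exact: leg_discrete_quantum_group. Qed.
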